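(* $F_v(2,2,2,2;J_4)=15$. Moreover, up to isomorphism there are exactly $5$ graphs in $\mathcal{F}_v(2,2,2,2;J_4;15)$; exactly $1$ of them is maximal $J_4$-free, and exactly $2$ of them are minimal (with respect to the arrowing $(2,2,2,2)^v$).
   Context: All graphs are finite, simple and undirected. $J_k$ denotes the complete graph $K_k$ with one edge removed. A graph $G$ is $H$-free if it contains no subgraph (not necessarily induced) isomorphic to $H$. For integers $a_1,\dots,a_r\ge 1$, $G\rightarrow(a_1,\dots,a_r)^v$ means that for every coloring of the vertices of $G$ with colors $1,\dots,r$ there is some color $i$ and a clique on $a_i$ vertices all of color $i$. The vertex Folkman number is $F_v(a_1,\dots,a_r;H)=\min\{|V(G)| : G \text{ is } H\text{-free and } G\rightarrow(a_1,\dots,a_r)^v\}$; $\mathcal{F}_v(a_1,\dots,a_r;H;n)$ is the set of $H$-free graphs on $n$ vertices with $G\rightarrow(a_1,\dots,a_r)^v$. A $J_4$-free graph is maximal $J_4$-free if adding any new edge creates a $J_4$. A graph $G$ with $G\rightarrow(a_1,\dots,a_r)^v$ is minimal if for every edge $e$, $G-e\not\rightarrow(a_1,\dots,a_r)^v$. Note $G\rightarrow(2,2,2,2)^v$ is equivalent to $\chi(G)\ge 5$. *)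

(* Defs.v *)
From mathcomp Require Import all_boot.

Set Implicit Arguments.
Unset Strict Implicit.
Unset Printing Implicit Defensive.

Record sgraph := SGraph {
  vertex :> finType;
  adj : rel vertex;
  adj_sym : symmetric adj;
  adj_irrefl : irreflexive adj
}.
Arguments adj {s} x y : rename.

Definition isomorphic (G H : sgraph) : Prop :=
  exists f : G -> H, bijective f /\ forall x y, adj (f x) (f y) = adj x y.

(* Not necessarily induced: non-edges of H may be sent to edges of G. *)
Definition has_subgraph (H G : sgraph) : Prop :=
  exists f : H -> G, injective f /\ forall x y, adj x y -> adj (f x) (f y).

Definition free (H G : sgraph) : Prop := ~ has_subgraph H G.

(* K_k minus the edge {0, 1}; meaningful for k >= 2. *)
Definition J_adj (k : nat) : rel 'I_k :=
  fun x y => (x != y) && ~~ ((x < 2) && (y < 2)).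

Fact J_adj_sym k : symmetric (@J_adj k).
Proof. by move=> x y; rewrite /J_adj eq_sym andbC [(y < 2) && _]andbC andbC. Qed.

Fact J_adj_irrefl k : irreflexive (@J_adj k).
Proof. by move=> x; rewrite /J_adj eqxx. Qed.

Definition J (k : nat) : sgraph := SGraph (@J_adj_sym k) (@J_adj_irrefl k).

(* The conjunct x != y makes add_edge G u u = G. *)
Definition add_adj (G : sgraph) (u v : G) : rel G :=
  fun x y => adj x y || (x != y) && ([set x; y] == [set u; v]).

Fact add_adj_sym (G : sgraph) (u v : G) : symmetric (add_adj u v).
Proof. by move=> x y; rewrite /add_adj adj_sym eq_sym setUC. Qed.

Fact add_adj_irrefl (G : sgraph) (u v : G) : irreflexive (add_adj u v).
Proof. by move=> x; rewrite /add_adj adj_irrefl eqxx. Qed.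

Definition add_edge (G : sgraph) (u v : G) : sgraph :=
  SGraph (add_adj_sym u v) (add_adj_irrefl u v).

Definition del_adj (G : sgraph) (u v : G) : rel G :=
  fun x y => adj x y && ([set x; y] != [set u; v]).

Fact del_adj_sym (G : sgraph) (u v : G) : symmetric (del_adj u v).
Proof. by move=> x y; rewrite /del_adj adj_sym setUC. Qed.

Fact del_adj_irrefl (G : sgraph) (u v : G) : irreflexive (del_adj u v).
Proof. by move=> x; rewrite /del_adj adj_irrefl. Qed.

Definition del_edge (G : sgraph) (u v : G) : sgraph :=
  SGraph (del_adj_sym u v) (del_adj_irrefl u v).

Definition clique (G : sgraph) (A : {set G}) : Prop :=
  {in A &, forall x y, x != y -> adj x y}.

(* G -> (a_1, ..., a_r)^v, with the colors numbered from 0. *)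
Definition arrows (G : sgraph) (a : seq nat) : Prop :=
  forall c : G -> 'I_(size a),
  exists (i : 'I_(size a)) (A : {set G}),
    [/\ clique A, #|A| = nth 0 a i & {in A, forall x, c x = i}].

Definition Folkman_graph (a : seq nat) (H : sgraph) (n : nat) (G : sgraph) :
    Prop :=
  [/\ #|G| = n, free H G & arrows G a].

(* F_v(a_1, ..., a_r; H) = n, as a relation because the family of graphs over
   which the minimum is taken may be empty. *)
Definition vertex_Folkman_number (a : seq nat) (H : sgraph) (n : nat) : Prop :=
  (exists G, Folkman_graph a H n G) /\
  (forall m G, Folkman_graph a H m G -> n <= m).

Definition maximal_free (H G : sgraph) : Prop :=
  free H G /\
  forall u v : G, u != v -> ~~ adj u v -> has_subgraph H (add_edge u v).

Definition minimal_arrowing (a : seq nat) (G : sgraph) : Prop :=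
  arrows G a /\ forall u v : G, adj u v -> ~ arrows (del_edge u v) a.

(* Up to isomorphism there are exactly k graphs satisfying P. *)
Definition exactly_upto_iso (k : nat) (P : sgraph -> Prop) : Prop :=
  exists Gs : 'I_k -> sgraph,
    [/\ forall i, P (Gs i),
        forall i j, isomorphic (Gs i) (Gs j) -> i = j
      & forall G, P G -> exists i, isomorphic (Gs i) G].

(* Main.v *)
Require Import Defs.
From Stdlib Require Import BinNat.
From mathcomp Require Import all_boot.

Set Implicit Arguments.
Unset Strict Implicit.
Unset Printing Implicit Defensive.

(** Let G be J_4-free with 15 vertices and chromatic number at least 5 (smaller
    graphs are padded with isolated vertices).

    If G has an independent set I of size 5, then the remaining 10 vertices induce
    a graph H with no 3-coloring. Either H has no independent set of size 4 and is
    one of the five such J_4-free graphs, or H is obtained from a 6-vertex graph by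
    adding 4 independent vertices whose neighborhoods together block all
    3-colorings. Likewise the neighborhoods of the vertices of I must block all
    4-colorings of H; already the coloring blocked by the fewest admissible
    neighborhoods leaves almost no choice.

    If G has no independent 5-set, let v have minimum degree d. The non-neighbors
    of v induce a J_4-free graph without independent 4-sets, so there are at most
    10 of them and d >= 4; the degrees of a triangle add up to at most 18, so
    d <= 6. The neighborhood of v induces a matching, and the traces of its
    vertices on the non-neighbors satisfy strong pairwise constraints, which leave
    few graphs; all are 4-colorable or among the five.

    The J_4-free graphs without independent k-sets are generated one vertex at a
    time up to isomorphism. *)

(** * Boolean rows and adjacency codes *)

Notation row := (seq bool).

Fixpoint meets (a b : row) : bool :=
  match a, b with
  | x :: a', y :: b' => if x then (if y then true else meets a' b') else meets a' b'
  | _, _ => false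
  end.

Fixpoint band (a b : row) : row :=
  match a, b with x :: a', y :: b' => (x && y) :: band a' b' | _, _ => [::] end.

Fixpoint bor (a b : row) : row :=
  match a, b with x :: a', y :: b' => (x || y) :: bor a' b' | _, _ => [::] end.

Fixpoint noneb (a : row) : bool :=
  if a is x :: a' then (if x then false else noneb a') else true.

Fixpoint atmost1 (a : row) : bool :=
  if a is x :: a' then (if x then noneb a' else atmost1 a') else true.

Fixpoint eqrow (a b : row) : bool :=
  match a, b with
  | [::], [::] => true
  | x :: a', y :: b' =>
    if x then (if y then eqrow a' b' else false)
    else (if y then false else eqrow a' b')
  | _, _ => false
  end.

Fixpoint eqrows (a b : seq row) : bool :=
  match a, b with
  | [::], [::] => true
  | x :: a', y :: b' => if eqrow x y then eqrows a' b' else false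
  | _, _ => false
  end.

Fixpoint lerow (a b : row) : bool :=
  match a, b with
  | x :: a', y :: b' =>
    if x then (if y then lerow a' b' else false)
    else (if y then true else lerow a' b')
  | _, _ => true
  end.

(* Triangular on purpose: prepending a vertex to the ordering only conses a
   row, and every search below recurses structurally on the code. *)
Fixpoint code (A : Type) (e : rel A) (s : seq A) : seq row :=
  if s is x :: s' then map (e x) s' :: code e s' else [::].

Fixpoint consrow (r : row) (F : seq row) : seq row :=
  match r, F with b :: r', m :: F' => (b :: m) :: consrow r' F' | _, _ => [::] end.

(** The symmetric adjacency matrix, with [false] on the diagonal, recovered from a triangular
    code. *)
Fixpoint full (T : seq row) : seq row :=
  if T is t :: T' then (false :: t) :: consrow t (full T') else [::].

Lemma meets_map A (f g : A -> bool) s :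
  meets (map f s) (map g s) = has (fun x => f x && g x) s.
Proof. by elim: s => //= x s ->; case: (f x); case: (g x). Qed.

Lemma meets_mask A (f : A -> bool) m s : meets m (map f s) = has f (mask m s).
Proof. by elim: s m => [|x s IH] [|[] m] //=; rewrite ?IH //; case: (f x). Qed.

Lemma meetsC a b : meets a b = meets b a.
Proof. by elim: a b => [|x a IH] [|y b] //=; rewrite IH; case: x; case: y. Qed.

Lemma band_map A (f g : A -> bool) s :
  band (map f s) (map g s) = map (fun x => f x && g x) s.
Proof. by elim: s => //= x s ->. Qed.

Lemma bor_map A (f g : A -> bool) s :
  bor (map f s) (map g s) = map (fun x => f x || g x) s.
Proof. by elim: s => //= x s ->. Qed.

Lemma noneb_map A (f : A -> bool) s : noneb (map f s) = ~~ has f s.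
Proof. by elim: s => //= x s ->; case: (f x). Qed.

Lemma atmost1_mapP (A : eqType) (f : A -> bool) s : uniq s ->
  reflect {in s &, forall a b, f a -> f b -> a = b} (atmost1 (map f s)).
Proof.
elim: s => [|x s IH] /=; first by constructor.
case/andP=> xs /IH {}IH; case fx: (f x); last first.
  apply: (iffP IH) => H a b; last by move=> aS bS; apply: H; rewrite inE ?aS ?bS orbT.
  by rewrite !inE => /predU1P[->|aS] /predU1P[->|bS]; rewrite ?fx //; apply: H.
rewrite noneb_map; apply: (iffP hasPn) => H.
  move=> a b; rewrite !inE => /predU1P[->|aS] /predU1P[->|bS] // fa fb.
  - by case/negP: (H _ bS).
  - by case/negP: (H _ aS).
  - by case/negP: (H _ aS).
move=> y yS; apply/negP=> fy; case/negP: xs.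
by rewrite (H x y) ?mem_head // inE yS orbT.
Qed.

Lemma eqrowE a b : eqrow a b = (a == b).
Proof. by elim: a b => [|[] a IH] [|[] b] //=; rewrite IH. Qed.

Lemma eqrowsE a b : eqrows a b = (a == b).
Proof.
elim: a b => [|x a IH] [|y b] //=.
by rewrite eqrowE eqseq_cons IH; case: (x == y).
Qed.

Lemma lerow_total : total lerow.
Proof. by elim=> [|x a IH] [|y b] //=; case: x; case: y. Qed.

Lemma code_map (A B : Type) (f : A -> B) e e' s :
  (forall x y, e (f x) (f y) = e' x y) -> code e (map f s) = code e' s.
Proof. by move=> H; elim: s => //= x s ->; rewrite -map_comp (eq_map (H x)). Qed.

Lemma size_code (A : Type) (e : rel A) s : size (code e s) = size s.
Proof. by elim: s => //= x s ->. Qed.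

Lemma code_iotaP (A : Type) (e : rel A) (e' : rel nat) x0 s :
  code e s = code e' (iota 0 (size s)) <->
  forall i j, i < j < size s -> e (nth x0 s i) (nth x0 s j) = e' i j.
Proof.
(* Labels run through an arbitrary [f], so that the induction can shift the positions of the tail by
   one. *)
have H (f : nat -> nat) : code e s = code e' (map f (iota 0 (size s))) <->
  forall i j, i < j < size s -> e (nth x0 s i) (nth x0 s j) = e' (f i) (f j).
  elim: s f => [|x s IH] f /=; first by split=> // _ i j; rewrite ltn0 andbF.
  rewrite -[1]/(1 + 0) iotaDl -[map f (map _ _)]map_comp; set g := f \o addn 1; split.
    case=> Ex /(IH g) Es [|i] [|j] //; rewrite ltnS /= => lt_j.
      have := congr1 (fun r => nth false r j) Ex.
      by rewrite (nth_map x0) // (nth_map 0) ?size_map ?size_iota //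
      (nth_map 0) ?size_iota // nth_iota.
    exact: Es.
  move=> Es; congr (_ :: _); last by apply/(IH g) => i j lt_ij; apply: (Es i.+1 j.+1).
  apply: (@eq_from_nth _ false); rewrite !size_map ?size_iota // => j lt_j.
  rewrite (nth_map x0) // (nth_map 0) ?size_map ?size_iota //
      (nth_map 0) ?size_iota // nth_iota //.
  by rewrite -(Es 0 j.+1).
by have := H id; rewrite map_id.
Qed.

Lemma consrow_map A (f : A -> bool) (g : A -> row) s :
  consrow (map f s) (map g s) = [seq f y :: g y | y <- s].
Proof. by elim: s => //= y s ->. Qed.

Lemma full_code (A : Type) (e : rel A) s : symmetric e -> irreflexive e ->
  full (code e s) = [seq map (e x) s | x <- s].
Proof.
move=> e_sym e_irr; elim: s => //= x s ->; rewrite e_irr; congr (_ :: _).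
have: map (e x) s = map (fun y => e y x) s by apply: eq_map => y; rewrite e_sym.
by move->; rewrite consrow_map.
Qed.

(** * Generating small J_4-free graphs *)

(* Pairs (r, q): r is a set of vertices inducing a matching, q its matched
   vertices. In a J_4-free graph every neighborhood is such an r. *)
Fixpoint match_rows (T : seq row) : seq (row * row) :=
  if T is t :: T' then
    let R := match_rows T' in
    [seq (false :: rq.1, false :: rq.2) | rq <- R] ++
    flatten [seq let c := band t rq.1 in
             if atmost1 c && ~~ meets c rq.2
             then [:: (true :: rq.1, ~~ noneb c :: bor rq.2 c)] else [::] | rq <- R]
  else [:: ([::], [::])].

(* An edge inside the neighborhood of a new vertex cannot already lie in a
   triangle. *)
Definition edge_ok (F : seq row) (r : row) : bool :=
  all (fun p => if p.1 then
         all (fun q => if q.1.1 && q.1.2 then ~~ meets p.2 q.2 else true)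
             (zip (zip r p.2) F)
       else true) (zip r F).

Definition cands (T : seq row) : seq row :=
  let F := full T in [seq r <- unzip1 (match_rows T) | edge_ok F r].

Fixpoint indep (k : nat) (T : seq row) : seq row :=
  if T is t :: T' then
    map (cons false) (indep k T') ++
    (if k is k'.+1
     then map (cons true) [seq a <- indep k' T' | ~~ meets a t] else [::])
  else if k is 0 then [:: [::]] else [::].

(** * Isomorphism rejection and one-vertex extensions *)

Fixpoint relabel (F : seq row) (p : seq nat) : seq row :=
  if p is i :: p' then
    (let r := nth [::] F i in [seq nth false r j | j <- p']) :: relabel F p'
  else [::].

Fixpoint row_sum (r : row) (w : seq N) : N :=
  match r, w with
  | b :: r', x :: w' => if b then N.add x (row_sum r' w') else row_sum r' w'
  | _, _ => N0
  end.

(** Degrees, refined twice by summing x + x^2 over the neighbors; the square helps to separate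
    neighborhoods with equal plain sums. *)
Definition weights (F : seq row) : seq N :=
  let sq x := N.add x (N.mul x x) in
  let next w := [seq row_sum r (map sq w) | r <- F] in
  next (next [seq row_sum r (map (fun=> Npos xH) F) | r <- F]).

Definition total_weight (w : seq N) : N :=
  foldr N.add N0 [seq N.add x (N.mul x x) | x <- w].

Fixpoint agree (r rj : row) (imgs : seq nat) : bool :=
  match imgs, r with
  | i :: im, b :: r' => if eqb b (nth false rj i) then agree r' rj im else false
  | _, _ => true
  end.

(** Backtracking: the vertices listed in [rs] receive images from [js] one by one, of equal weight
    and with the right adjacencies to the images [imgs] chosen before. *)
Fixpoint find_iso (rs : seq (row * N)) (js : seq (nat * (row * N)))
    (imgs : seq nat) : option (seq nat) :=
  if rs is (r, k) :: rs' then
    (fix go l :=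
       if l is (j, (rj, kj)) :: l' then
         if (if N.eqb k kj then agree r rj imgs && ~~ has (eqn j) imgs else false)
         then (if find_iso rs' js (rcons imgs j) is Some p then Some p else go l')
         else go l'
       else None) js
  else Some imgs.

Record wcode := WCode {
  wrows : seq row; wfull : seq row; wts : seq N; wkey : N }.

Definition wcode_of T :=
  let F := full T in let w := weights F in WCode T F w (total_weight w).

(* find_iso and the weights are heuristics: soundness rests only on the final
   test that p is a permutation relabelling g as h. *)
Definition same (g h : wcode) : bool :=
  if N.eqb (wkey g) (wkey h) then
    if find_iso (zip (wfull h) (wts h))
         (zip (iota 0 (size (wrows g))) (zip (wfull g) (wts g))) [::] is Some p
    then perm_eq p (iota 0 (size (wrows g))) && eqrows (relabel (wfull g) p) (wrows h)
    else false
  else false.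

Fixpoint insert_all (l : seq (seq row)) (acc : seq wcode) : seq wcode :=
  if l is T :: l' then
    let g := wcode_of T in
    insert_all l' (if has (same g) acc then acc else g :: acc)
  else acc.

Definition dedup (l : seq (seq row)) := map wrows (insert_all l [::]).

(** The new neighborhood must meet every independent (k-1)-set, since a missed one would form an
    independent k-set with the new vertex. *)
Definition vertex_exts k (T : seq row) : seq (seq row) :=
  let I := indep k.-1 T in [seq r :: T | r <- cands T & all (meets r) I].

Definition step k (L : seq (seq row)) := dedup (flatten (map (vertex_exts k) L)).

(* Represents, up to isomorphism, all J_4-free graphs on n vertices without an
   independent k-set. *)
Fixpoint gen k n := if n is n'.+1 then step k (gen k n') else [:: [::]].

(** * Completeness of the generation *)

Section Completeness.

Variable G : sgraph.

(** The working form of J_4-freeness: every edge lies in at most one triangle. [freeP] links it to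
    [free (J 4)]. *)
Definition diamond_free := forall x y a b : G,
  adj x y -> adj x a -> adj y a -> adj x b -> adj y b -> a = b.

Definition stable (t : seq G) := allrel (fun x y => ~~ adj x y) t t.

Definition no_stable k (s : seq G) :=
  forall t, uniq t -> {subset t <= s} -> stable t -> size t <> k.

Local Notation nb s x := (map (adj (x : G)) s).
Local Notation cd := (code (@adj G)).

Lemma stableP (t : seq G) : reflect {in t &, forall x y, ~~ adj x y} (stable t).
Proof. exact: allrelP. Qed.

Lemma stable_cons x (t : seq G) : stable (x :: t) = ~~ has (adj x) t && stable t.
Proof.
apply/stableP/andP=> [H|[/hasPn Hx /stableP Ht] y z].
  split; last by apply/stableP => y z yt zt; apply: H; rewrite inE ?yt ?zt orbT.
  by apply/hasPn=> y yt; apply: H; rewrite inE ?eqxx ?yt ?orbT.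
rewrite !inE => /predU1P[->|yt] /predU1P[->|zt]; rewrite ?adj_irrefl //.
- exact: Hx.
- by rewrite adj_sym; apply: Hx.
- exact: Ht.
Qed.

Lemma full_cd s : full (cd s) = [seq nb s x | x <- s].
Proof. by apply: full_code; [apply: adj_sym | apply: adj_irrefl]. Qed.

(** When x joins the neighborhood of z, it has at most one neighbor u there, because zx lies in at
    most one triangle. This u has no earlier partner y, or zu would lie in triangles with both x and
    y. *)
Lemma match_rows_complete s z : diamond_free -> uniq s ->
  (nb s z, [seq adj z u && has (fun y => adj z y && adj u y) s | u <- s])
    \in match_rows (cd s).
Proof.
move=> dfG; elim: s => //= x s IH /andP[xs us]; rewrite mem_cat adj_irrefl andbF /=.
have := IH us; set q := [seq adj z u && has _ s | u <- s] => rq_in.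
case zx: (adj z x) => /=; last first.
  apply/orP; left; apply/mapP; exists (nb s z, q) => //=; congr (_, _ :: _).
apply/orP; right; apply/flatten_mapP; exists (nb s z, q) => //=.
rewrite band_map /q meets_map bor_map noneb_map negbK.
have -> /= : atmost1 [seq adj x y && adj z y | y <- s].
  apply/atmost1_mapP=> // a b _ _ /andP[xa za] /andP[xb zb].
  exact: (dfG z x).
have -> /= : ~~ has (fun y => adj x y && adj z y &&
    (adj z y && has (fun y0 => adj z y0 && adj y y0) s)) s.
  apply/hasPn=> u us'; apply/negP => /andP[/andP[xu zu] /andP[_ /hasP[y ys /andP[zy uy]]]].
  have E : x = y by apply: (dfG z u) => //; rewrite adj_sym.
  by rewrite E ys in xs.
rewrite inE; apply/eqP; congr (_, _ :: _).
  by apply: eq_has => y; rewrite andbC.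
apply: eq_map => u; rewrite (adj_sym u x).
by case: (adj z u); case: (adj x u); rewrite ?orbT ?orbF.
Qed.

Lemma cands_complete s z : diamond_free -> uniq s -> z \notin s ->
  nb s z \in cands (cd s).
Proof.
move=> dfG us zs; rewrite mem_filter full_cd; apply/andP; split; last first.
  by apply/mapP; eexists; first exact: (match_rows_complete z dfG us).
rewrite /edge_ok; set F := [seq nb s x | x <- s].
have zipE (f : G -> bool) (g : G -> row) t :
    zip (map f t) (map g t) = map (fun x => (f x, g x)) t.
  by elim: t => //= x t ->.
rewrite {1}/F zipE all_map; apply/allP => x xs /=; case: ifP => // zx.
have zip3E (f g : G -> bool) (h : G -> row) t :
    zip (zip (map f t) (map g t)) (map h t) = map (fun x => (f x, g x, h x)) t.
  by elim: t => //= y t ->.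
rewrite zip3E all_map; apply/allP=> y ys /=; case: ifP => // /andP[zy xy].
rewrite meets_map; apply/hasPn => u us'; apply/negP=> /andP[xu yu].
have E : z = u by apply: (dfG x y) => //; rewrite adj_sym.
by rewrite E us' in zs.
Qed.

Lemma indep_sound s k m : uniq s -> m \in indep k (cd s) ->
  stable (mask m s) /\ size (mask m s) = k.
Proof.
elim: s k m => [|x s IH] k m /=; first by case: k => //; rewrite inE => _ /eqP->.
case/andP=> _ us; rewrite mem_cat => /orP[/mapP[m' m'in ->]|].
  exact: IH.
case: k => // k /mapP[m']; rewrite mem_filter => /andP[nm m'in] -> /=.
have [st ->] := IH _ _ us m'in; split=> //.
by rewrite stable_cons st andbT -meets_mask.
Qed.

Lemma relabel_cd x0 s p : all (gtn (size s)) p ->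
  relabel [seq nb s x | x <- s] p = cd [seq nth x0 s i | i <- p].
Proof.
elim: p => //= i p IH /andP[lt_i lt_p]; rewrite IH //; congr (_ :: _).
rewrite (nth_map x0) // -map_comp; apply/eq_in_map => j jp /=.
by rewrite (nth_map x0) //; apply: (allP lt_p).
Qed.

Lemma same_sound s h : same (wcode_of (cd s)) h ->
  exists2 s', perm_eq s' s & cd s' = wrows h.
Proof.
rewrite /same; case: ifP => // _; case: find_iso => // p /andP[] /=.
rewrite full_cd eqrowsE size_code => perm_p /eqP Eh.
case: s perm_p Eh => [|x0 s]; first by move=> /perm_size /size0nil -> <-; exists [::].
set t := x0 :: s => perm_p <-; exists [seq nth x0 t i | i <- p].
  by rewrite -{2}(mkseq_nth x0 t) perm_map.
rewrite (relabel_cd x0) //; apply/allP=> i.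
by rewrite (perm_mem perm_p) mem_iota.
Qed.

Lemma dedup_complete l s : cd s \in l ->
  exists2 s', perm_eq s' s & cd s' \in dedup l.
Proof.
rewrite /dedup; move: [::] => acc.
have sub l' : forall acc h, h \in map wrows acc -> h \in map wrows (insert_all l' acc).
  elim: l' => //= T l' IH acc' h hin; apply: IH.
  by case: ifP => // _; rewrite inE hin orbT.
have has_same acc0 : has (same (wcode_of (cd s))) acc0 ->
    exists2 s', perm_eq s' s & cd s' \in map wrows acc0.
  elim: acc0 => //= h acc' IH /orP[/same_sound[s' ps' Es']|/IH[s' ps' s'in]]; exists s' => //.
    by rewrite inE Es' eqxx.
  by rewrite inE s'in orbT.
elim: l acc => //= T l IH acc; rewrite inE => /predU1P[<-|]; last exact: IH.
case: ifP => [/has_same[s' ps' s'in]|_]; first by exists s' => //; apply: sub.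
by exists s => //; apply: sub; rewrite inE eqxx.
Qed.

(** Induction on s: the tail is reordered so that its code is in the list, and the row of x over it
    is an admissible extension. [dedup] may replace the result by an isomorphic code, which only
    reorders the vertices again. *)
Lemma gen_complete k s : diamond_free -> 0 < k -> uniq s -> no_stable k s ->
  exists2 s', perm_eq s' s & cd s' \in gen k (size s).
Proof.
move=> dfG k_gt0; elim: s => [|x s IH] /=; first by exists [::].
case/andP=> xs us ns; have [|s1 ps1 s1in] := IH us.
  by move=> t ut ts; apply: ns => // y /ts; rewrite inE => ->; rewrite orbT.
have us1 : uniq s1 by rewrite (perm_uniq ps1).
have [|s' ps' s'in] := @dedup_complete (flatten (map (vertex_exts k) (gen k (size s)))) (x :: s1).
  apply/flatten_mapP; exists (cd s1) => //; apply/mapP; exists (nb s1 x) => //.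
  rewrite mem_filter cands_complete ?(perm_mem ps1) // andbT.
  apply/allP=> m min; rewrite meetsC meets_mask; apply/negPn/negP=> nm.
  have [st sz] := indep_sound us1 min.
  case: (ns (x :: mask m s1)).
  - by rewrite /= mask_uniq // andbT; apply: contra xs => /mem_mask; rewrite (perm_mem ps1).
  - move=> y; rewrite !inE => /predU1P[->|/mem_mask]; first by rewrite eqxx.
    by rewrite (perm_mem ps1) => ->; rewrite orbT.
  - by rewrite stable_cons nm.
  - by rewrite /= sz prednK.
by exists s' => //; apply: perm_trans ps' _; rewrite perm_cons.
Qed.

End Completeness.

(** * Adding independent vertices that block all colorings *)

Fixpoint place (t : row) (c : seq row) : seq (seq row) :=
  if c is m :: c' then
    (if meets t m then [::] else [:: (true :: m) :: map (cons false) c']) ++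
    (if noneb m then [::] else map (cons (false :: m)) (place t c'))
  else [::].

(* Colorings are lists of k class masks; a vertex may open only the first
   empty class, so each partition is listed once. *)
Fixpoint colorings k (T : seq row) : seq (seq row) :=
  if T is t :: T' then flatten [seq place t c | c <- colorings k T']
  else [:: nseq k [::]].

(** A vertex with neighborhood r sees every class of c, so c leaves it no color. *)
Definition blocks (c : seq row) (r : row) := all (meets r) c.

Fixpoint inner_edges (T : seq row) (s : row) : seq row :=
  match T, s with
  | t :: T', b :: s' => (if b then band t s' else [::]) :: inner_edges T' s'
  | _, _ => [::]
  end.

Fixpoint spans_edge (T : seq row) (r : row) : bool :=
  match T, r with
  | t :: T', b :: r' =>
    if (if b then meets t r' else false) then true else spans_edge T' r'
  | _, _ => false
  end.

(** Two vertices whose neighborhoods share an edge would form a J_4 with it. The edges inside s are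
    computed once and reused for every r. *)
Definition compat (T : seq row) (s : row) : row -> bool :=
  let E := inner_edges T s in fun r => ~~ spans_edge E r.

(* Lists, up to order, the m-sets of neighborhoods for which every coloring in
   cls is blocked. Once a candidate has been explored it is discarded from cs, so
   that no m-set is listed for several of its orders. *)
Fixpoint pick (T : seq row) m (cs : seq row) (cls : seq (seq row)) : seq (seq row) :=
  if m is m'.+1 then
    (fix branch (L cs : seq row) :=
       if L is s :: L' then
         [seq s :: sol | sol <- pick T m' (filter (compat T s) cs)
                                  [seq c <- cls | ~~ blocks c s]]
         ++ branch L' [seq r <- cs | ~~ eqrow s r]
       else [::])
      (if cls is c :: _ then [seq r <- cs | blocks c r] else cs) cs
  else if cls is [::] then [:: [::]] else [::].

(** [pick] branches on the first coloring not yet blocked, so the colorings with the fewest blocking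
    candidates come first. *)
Definition sort_colorings (cs : seq row) (cls : seq (seq row)) : seq (seq row) :=
  map snd (sort (fun a b => a.1 <= b.1) [seq (count (blocks c) cs, c) | c <- cls]).

Definition pick_all k m (T : seq row) : seq (seq row) :=
  let cs := cands T in
  let cls := colorings k T in
  if has (fun c => ~~ has (blocks c) cs) cls then [::]
  else pick T m cs (sort_colorings cs cls).

Fixpoint attach (f : rel nat) i (rows T : seq row) : seq row :=
  if rows is r :: rs then
    ([seq f i j | j <- iota i.+1 (size rs)] ++ r) :: attach f i.+1 rs T
  else T.

Definition stable_exts k m (L : seq (seq row)) : seq (seq row) :=
  dedup (flatten
    [seq [seq attach (fun _ _ => false) 0 rs T | rs <- pick_all k m T] | T <- L]).

(** * Backtracking searches *)

Fixpoint lazy_has A (p : A -> bool) (s : seq A) : bool :=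
  if s is x :: s' then (if p x then true else lazy_has p s') else false.

Fixpoint clash (a : nat) (t : row) (c : seq nat) : bool :=
  match t, c with
  | b :: t', x :: c' =>
    if b then (if eqn a x then true else clash a t' c') else clash a t' c'
  | _, _ => false
  end.

(* Backtracking in continuation-passing style; some_col tries colors only up to
   symmetry and is relied upon only when it succeeds, any_col is exhaustive. *)
Fixpoint search_col (palette : seq nat -> seq nat) (T : seq row)
    (K : seq nat -> bool) : bool :=
  if T is t :: T' then
    search_col palette T'
      (fun c => lazy_has (fun a => if clash a t c then false else K (a :: c)) (palette c))
  else K [::].

Definition some_col k (T : seq row) :=
  search_col (fun c => iota 0 (minn k (foldr maxn 0 (map S c)).+1)) T xpredT.

Definition any_col k (T : seq row) := search_col (fun=> iota 0 k) T xpredT.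

Fixpoint filter_from (test : nat -> row -> bool) j (cs : seq (seq row)) :=
  if cs is c :: cs' then filter (test j) c :: filter_from test j.+1 cs' else [::].

(** Selects one row from each domain with forward checking: a choice at position i filters all later
    domains, and the branch ends as soon as one becomes empty. [fuel] must exceed the number of
    domains. *)
Fixpoint csp (test : nat -> row -> nat -> row -> bool) fuel i (cs : seq (seq row)) :
    seq (seq row) :=
  if fuel is n.+1 then
    if cs is c :: cs' then
      flatten [seq (let cs'' := filter_from (test i s) i.+1 cs' in
                    if has (@nilp _) cs'' then [::]
                    else map (cons s) (csp test n i.+1 cs'')) | s <- c]
    else [:: [::]]
  else [::].

(** * Blocked colorings and completeness of the extensions by independent sets *)

Section Colorings.

Variable G : sgraph.
Hypothesis dfG : diamond_free G.

Local Notation nb s x := (map (adj (x : G)) s).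
Local Notation cd := (code (@adj G)).

Definition colorable k (l : seq G) := exists c : G -> nat,
  (forall x, x \in l -> c x < k) /\ {in l &, forall x y, adj x y -> c x != c y}.

Lemma colorable_sub k (l l' : seq G) :
  {subset l' <= l} -> colorable k l -> colorable k l'.
Proof.
move=> sub [c [ck cp]]; exists c; split=> [x /sub|x y /sub xl /sub yl]; first exact: ck.
exact: cp.
Qed.

Lemma placeP t c c' : c' \in place t c -> exists c1 m c2,
  [/\ c = c1 ++ m :: c2, ~~ meets t m
    & c' = map (cons false) c1 ++ (true :: m) :: map (cons false) c2].
Proof.
elim: c c' => //= m c IH c'; rewrite mem_cat => /orP[].
  case: ifP => // /negbT nm; rewrite inE => /eqP->.
  by exists [::], m, c.
case: ifP => // _ /mapP[d /IH[c1 [m' [c2 [-> nm ->]]]] ->].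
by exists (m :: c1), m', c2.
Qed.

Lemma coloringsP k s c : uniq s -> c \in colorings k (cd s) ->
  [/\ size c = k, forall m, m \in c -> stable (mask m s)
    & forall x, x \in s -> has (fun m => x \in mask m s) c].
Proof.
elim: s c => [|x s IH] c /=.
  by rewrite inE => _ /eqP->; split=> [|m _|//]; rewrite ?size_nseq ?mask0.
case/andP=> xs us /flatten_mapP[d din /placeP[c1 [m [c2 [Ed nm ->]]]]].
have {IH} [sz st cov] := IH d us din; split.
- by rewrite -sz Ed !size_cat /= !size_map.
- move=> m'; rewrite mem_cat inE => /orP[/mapP[m1 m1in ->] /=|/predU1P[->|/mapP[m1 m1in ->] /=]].
  + by apply: st; rewrite Ed mem_cat m1in.
  + rewrite /= stable_cons st ?Ed ?mem_cat ?mem_head ?orbT // andbT.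
    by rewrite -meets_mask meetsC.
  + by apply: st; rewrite Ed mem_cat inE m1in !orbT.
move=> y; rewrite inE => /predU1P[->|ys].
  by rewrite has_cat /= mem_head orbT.
have /hasP[m' m'in ym'] := cov _ ys.
apply/hasP; move: m'in; rewrite Ed mem_cat inE => /or3P[m'in|/eqP E|m'in].
- by exists (false :: m') => //; rewrite mem_cat map_f.
- exists (true :: m); first by rewrite mem_cat mem_head orbT.
  by rewrite /= inE -E ym' orbT.
- by exists (false :: m') => //; rewrite mem_cat inE (map_f (cons false) m'in) !orbT.
Qed.

(** If no vertex of xs blocked c, each could join a class without neighbors of its own; as xs is
    stable, this would color xs ++ s. *)
Lemma not_colorable_blocks k s xs c : uniq s -> stable xs -> ~ colorable k (xs ++ s) ->
  c \in colorings k (cd s) -> has (fun x => blocks c (nb s x)) xs.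
Proof.
move=> us sxs ncol /(coloringsP us)[sz st cov]; apply/negPn/negP => /hasPn nb_xs.
(* A vertex of s takes the first class containing it, any other vertex the first class that its
   neighborhood misses. *)
apply: ncol; pose cls z := if z \in s then find (fun m => z \in mask m s) c
  else find (fun m => ~~ meets (nb s z) m) c.
have clsP z : z \in xs ++ s -> exists2 m, m \in c & nth [::] c (cls z) = m /\
   if z \in s then z \in mask m s else ~~ has (adj z) (mask m s).
  rewrite /cls mem_cat; case: ifP => zs.
    have hc := cov _ zs; exists (nth [::] c (find (fun m => z \in mask m s) c)).
      by rewrite mem_nth // -has_find.
    by split=> //; apply: (nth_find [::] hc).
  rewrite orbF => zxs; have hc : has (fun m => ~~ meets (nb s z) m) c.
    by rewrite has_predC; apply: nb_xs.
  exists (nth [::] c (find (fun m => ~~ meets (nb s z) m) c)).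
    by rewrite mem_nth // -has_find.
  by split=> //; rewrite -meets_mask meetsC; apply: (nth_find [::] hc).
exists cls; split=> [z|z w].
  rewrite mem_cat /cls -sz => zin; case: ifP zin => zs; first by rewrite -has_find cov.
  by rewrite orbF -has_find has_predC => zxs; apply: nb_xs.
move=> zin win zw; apply/eqP=> E.
have [m mc [Em mz]] := clsP _ zin; have [m' _ [Em' mw]] := clsP _ win.
have Emm : m' = m by rewrite -Em -Em' E.
move: mz mw; rewrite {}Emm; case: ifP => zs; case: ifP => ws.
- by move=> zm wm; move/stableP: (st _ mc) => /(_ _ _ zm wm); rewrite zw.
- by move=> zm /hasPn/(_ _ zm); rewrite adj_sym zw.
- by move=> /hasPn nz /nz; rewrite zw.
move: zin win; rewrite !mem_cat zs ws !orbF => zin win.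
by move/stableP: sxs => /(_ _ _ zin win); rewrite zw.
Qed.

Lemma spans_edgeP s (f g : G -> bool) :
  spans_edge (inner_edges (cd s) (map f s)) (map g s) ->
  exists x y, [/\ adj x y, f x && f y & g x && g y].
Proof.
elim: s => //= x s IH; case: ifP => // xx _; move: xx.
case gx: (g x) => //; case fx: (f x); last by case: (map g s).
rewrite band_map meets_map => /hasP[y _ /andP[/andP[xy fy] gy]].
by exists x, y; rewrite fx gx fy gy.
Qed.

Lemma compat_nb s x y : x != y -> compat (cd s) (nb s x) (nb s y).
Proof.
move=> nxy; apply/negP=> /spans_edgeP[a [b [ab /andP[xa xb] /andP[ya yb]]]].
by case/eqP: nxy; apply: (dfG ab); rewrite adj_sym.
Qed.

(** The loop over L stops at the first row that is the neighborhood of some x in xs and chooses it;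
    the rows discarded before belong to no vertex of xs. A chosen row stays available below its own
    branch unless [compat] excludes it, so equal neighborhoods are not lost. *)
Lemma pick_complete s m cs cls xs : size xs = m -> uniq xs ->
  {in xs, forall x, nb s x \in cs} ->
  {in cls, forall c, has (fun x => blocks c (nb s x)) xs} ->
  exists2 xs', perm_eq xs' xs & [seq nb s x | x <- xs'] \in pick (cd s) m cs cls.
Proof.
elim: m cs cls xs => [|m IH] cs cls xs /= sz uxs in_cs blk.
  rewrite (size0nil sz) in blk *; exists [::] => //.
  by case: cls blk => // c cls /(_ c (mem_head _ _)).
set L := (if cls is c :: _ then _ else _).
(* Some vertex of xs blocks the first coloring; if no coloring is left, any vertex of xs serves. *)
have : has (fun x => nb s x \in L) xs.
  rewrite /L; case: (cls) blk => [_|c cls' /(_ c (mem_head _ _)) /hasP[x xin bx]].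
    case: (xs) sz in_cs => // x xs' _ /(_ x (mem_head _ _)) xc.
    by rewrite /= xc.
  by apply/hasP; exists x => //; rewrite mem_filter bx in_cs.
clearbody L; elim: L cs in_cs => [|r L IHL] cs in_cs; first by case/hasP.
move=> hL; case rin: (r \in [seq nb s x | x <- xs]).
  have /mapP[x xin Er] := rin; have px := perm_to_rem xin.
  have [||||xs' pxs' xs'in] := IH (filter (compat (cd s) r) cs)
    [seq c <- cls | ~~ blocks c r] (rem x xs).
  - by rewrite size_rem // sz.
  - exact: rem_uniq.
  - move=> y; rewrite (mem_rem_uniq _ uxs) inE => /andP[nyx yin].
    by rewrite mem_filter in_cs // Er compat_nb // eq_sym.
  - move=> c; rewrite mem_filter => /andP[nb_c /blk/hasP[y yin by_]].
    apply/hasP; exists y => //; rewrite (mem_rem_uniq _ uxs) inE yin andbT.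
    by apply: contra nb_c => /eqP Eyx; rewrite Er -Eyx.
  exists (x :: xs'); first by rewrite perm_sym (perm_trans px) // perm_cons perm_sym.
  by rewrite mem_cat; apply/orP; left; rewrite /= -Er; apply: map_f.
have [||xs' pxs' xs'in] := IHL [seq q <- cs | ~~ eqrow r q].
- move=> x xin; rewrite mem_filter in_cs // andbT eqrowE.
  by apply/eqP=> E; rewrite E (map_f (fun x => nb s x) xin) in rin.
- have /hasP[x xin] := hL; rewrite inE => /predU1P[E|xL]; last by apply/hasP; exists x.
  by rewrite -E (map_f (fun x => nb s x) xin) in rin.
by exists xs' => //; rewrite mem_cat xs'in orbT.
Qed.

Lemma attach_code f k ws s :
  (forall i j x0, i < j < size ws -> adj (nth x0 ws i) (nth x0 ws j) = f (k + i) (k + j)) ->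
  cd (ws ++ s) = attach f k [seq nb s w | w <- ws] (cd s).
Proof.
elim: ws k => //= w ws IH k Hf; rewrite map_cat size_map; congr (_ :: _).
  congr (_ ++ _); apply: (@eq_from_nth _ false); rewrite !size_map ?size_iota // => j lt_j.
  rewrite (nth_map w) // (nth_map 0) ?size_iota // nth_iota //.
  by have := Hf 0 j.+1 w; rewrite addn0 addnS => /(_ lt_j).
by apply: IH => i j x0 lt_ij; rewrite !addSnnS; apply: (Hf i.+1 j.+1).
Qed.

Lemma stable_exts_complete k m L s xs : uniq (xs ++ s) -> stable xs -> size xs = m ->
  ~ colorable k (xs ++ s) -> cd s \in L ->
  exists2 s', perm_eq s' (xs ++ s) & cd s' \in stable_exts k m L.
Proof.
rewrite cat_uniq => /and3P[uxs /hasPn dis us] sxs sz ncol sL.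
have in_cs : {in xs, forall x, nb s x \in cands (cd s)}.
  move=> x xin; apply: cands_complete => //.
  by apply/negP=> /dis; rewrite xin.
have blk := not_colorable_blocks us sxs ncol.
have [xs' pxs' xs'in] : exists2 xs', perm_eq xs' xs &
    [seq nb s x | x <- xs'] \in pick_all k m (cd s).
  rewrite /pick_all; case: ifP => [/hasP[c /blk/hasP[x xin bx] /hasPn/(_ _ (in_cs _ xin))]|_].
    by rewrite bx.
  apply: pick_complete => // c /mapP[[n c'] /=]; rewrite mem_sort => /mapP[c'' cin [_ ->] ->].
  exact: blk.
have [|s' ps' s'in] := @dedup_complete G (flatten
    [seq [seq attach (fun _ _ => false) 0 rs T | rs <- pick_all k m T] | T <- L]) (xs' ++ s).
  apply/flatten_mapP; exists (cd s) => //; apply/mapP.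
  exists [seq nb s x | x <- xs'] => //; apply: attach_code => i j x0 /andP[ij lt_j].
  apply/negbTE; move/stableP: sxs; apply; rewrite -(perm_mem pxs') mem_nth //.
  exact: ltn_trans lt_j.
by exists s' => //; rewrite (perm_trans ps') // perm_cat2r.
Qed.

End Colorings.

(** * Gluing a neighborhood to the non-neighbors *)

Lemma lazy_hasE A (p : A -> bool) s : lazy_has p s = has p s.
Proof. by elim: s => //= x s ->; case: (p x). Qed.

Lemma clash_map A a (g : A -> bool) (f : A -> nat) s :
  clash a (map g s) (map f s) = has (fun y => g y && (a == f y)) s.
Proof. by elim: s => //= x s ->; rewrite -eqnE; case: (g x); case: eqn. Qed.

(** Any palette with colors below k is sound, which covers both [some_col] and [any_col]. The
    continuation K is generalized because the choice for x is made inside the continuation for the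
    tail. *)
Lemma search_col_sound (A : eqType) (e : rel A) palette k s K :
  symmetric e -> irreflexive e -> uniq s -> (forall c a, a \in palette c -> a < k) ->
  search_col palette (code e s) K -> exists f : A -> nat,
    [/\ {in s, forall x, f x < k}, {in s &, forall x y, e x y -> f x != f y} & K (map f s)].
Proof.
move=> e_sym e_irr us pal_k; elim: s K us => [|x s IH] K /=; first by exists (fun=> 0).
case/andP=> xs us /(IH _ us)[f [fk fp]]; rewrite lazy_hasE => /hasP[a /pal_k ak].
rewrite clash_map; case: ifP => // /negbT/hasPn ncl Ka.
pose f' z := if z == x then a else f z; exists f'.
have f's y : y \in s -> f' y = f y.
  by rewrite /f'; case: eqP => // -> xin; rewrite xin in xs.
have ncl' y : y \in s -> e x y -> a != f y.
  by move=> ys xy; have := ncl y ys; rewrite xy.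
have f'x : f' x = a by rewrite /f' eqxx.
have f's_map : map f' s = map f s by apply/eq_in_map.
split; last by rewrite /= f'x f's_map.
- by move=> y; rewrite inE => /predU1P[->|ys]; rewrite ?f'x // f's // fk.
- move=> y z; rewrite !inE => /predU1P[->|ys] /predU1P[->|zs].
  + by rewrite e_irr.
  + by rewrite f'x f's //; apply: ncl'.
  + by rewrite f'x f's // e_sym eq_sym; apply: ncl'.
  + by rewrite !f's //; apply: fp.
Qed.

(** The full palette contains f x for every x, so the branch that follows f is explored. *)
Lemma search_col_complete (A : eqType) (e : rel A) k (f : A -> nat) s (K : seq nat -> bool) :
  {in s, forall x, f x < k} -> {in s &, forall x y, e x y -> f x != f y} -> uniq s ->
  irreflexive e -> K (map f s) -> search_col (fun=> iota 0 k) (code e s) K.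
Proof.
move=> fk fp us e_irr; elim: s K fk fp us => //= x s IH K fk fp /andP[xs us] Kf.
apply: IH => //.
- by move=> y ys; apply: fk; rewrite inE ys orbT.
- by move=> y z ys zs; apply: fp; rewrite inE ?ys ?zs orbT.
rewrite lazy_hasE; apply/hasP; exists (f x); first by rewrite mem_iota fk ?mem_head.
rewrite clash_map; case: ifP => // /hasP[y ys /andP[xy /eqP E]].
by have := fp x y; rewrite mem_head inE ys orbT E eqxx; move/(_ isT isT xy).
Qed.

(* Positions iso + 2 l and iso + 2 l + 1 are mates; those below iso have none. *)
Definition mate iso i j := [&& iso <= i, j == i.+1 & ~~ odd (i - iso)].

(* Necessary conditions on the traces s, r of the i-th and j-th neighbors of v
   on the set of non-neighbors; U3 lists its independent triples. *)
Definition nb_test iso (U3 T : seq row) i (s : row) : nat -> row -> bool :=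
  let U := [seq t <- U3 | ~~ meets t s] in
  let E := inner_edges T s in
  fun j r =>
    if mate iso i j then lerow s r && ~~ meets s r
    else (if (j == i.+1) && (j < iso) then lerow s r else true) &&
         all (meets r) U && ~~ spans_edge E r.

(* Codes of v :: N(v) ++ S, where T is the code of the non-neighbors S of v and
   N(v) consists of iso isolated vertices followed by matched pairs. *)
Definition nbhd_exts iso d (T : seq row) : seq (seq row) :=
  let cs := cands T in
  [seq (nseq d true ++ nseq (size T) false) :: attach (mate iso) 0 rs T |
    rs <- csp (nb_test iso (indep 3 T) T) d.+1 0
            [seq [seq r <- cs | d <= (count id r).+1 + (iso <= i)] | i <- iota 0 d]].

Lemma nth_filter_from test j cs k : k < size cs ->
  nth [::] (filter_from test j cs) k = filter (test (j + k)) (nth [::] cs k).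
Proof.
elim: cs j k => // c cs IH j [|k] /= lt_k; first by rewrite addn0.
by rewrite IH // addSnnS.
Qed.

Lemma size_filter_from test j cs : size (filter_from test j cs) = size cs.
Proof. by elim: cs j => //= c cs IH j; rewrite IH. Qed.

Lemma csp_complete (test : nat -> row -> nat -> row -> bool) fuel i cs rs :
  size cs < fuel -> size rs = size cs ->
  (forall k, k < size rs -> nth [::] rs k \in nth [::] cs k) ->
  (forall k l, k < l < size rs -> test (i + k) (nth [::] rs k) (i + l) (nth [::] rs l)) ->
  rs \in csp test fuel i cs.
Proof.
elim: fuel i cs rs => // n IH i [|c cs] [|r rs] //= lt_n [sz] mem tst.
apply/flatten_mapP; exists r; first exact: (mem 0).
have mem' k : k < size rs ->
    nth [::] rs k \in nth [::] (filter_from (test i r) i.+1 cs) k.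
  move=> lt_k; rewrite nth_filter_from -?sz // mem_filter (mem k.+1) // andbT.
  by have := tst 0 k.+1; rewrite addn0 addSnnS; apply.
case: ifP => [/hasP[c' /(nthP [::])[k lt_k <-] /nilP E]|_].
  rewrite size_filter_from -sz in lt_k.
  by have := mem' _ lt_k; rewrite E.
rewrite map_f // IH ?size_filter_from // => k l lt_kl.
by rewrite !addSnnS; apply: (tst k.+1 l.+1).
Qed.

(** * Ordering a neighborhood and completeness of the gluing *)

Section Neighborhoods.

Variable G : sgraph.
Hypothesis dfG : diamond_free G.

Local Notation nb s x := (map (adj (x : G)) s).
Local Notation cd := (code (@adj G)).

(** Besides the positions of isolated vertices and mates, this fixes an order by [r] among the
    isolated vertices and within each pair, the symmetry breaking that [nb_test] enforces. *)
Definition matched_order (r : G -> row) iso (ws : seq G) := forall x0 i j,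
  i < j < size ws -> adj (nth x0 ws i) (nth x0 ws j) = mate iso i j /\
  (mate iso i j || (j == i.+1) && (j < iso) ->
     lerow (r (nth x0 ws i)) (r (nth x0 ws j))).

(** Induction on the size of W: a vertex without neighbor in W goes to us; otherwise it is removed
    with its unique partner, and the pair goes to the front of ws. Prepending two vertices preserves
    the parity in [mate 0]. *)
Lemma matching_split (r : G -> row) W : uniq W ->
  {in W & &, forall x y z, adj x y -> adj x z -> y = z} ->
  exists us ws, [/\ perm_eq (us ++ ws) W, ~~ odd (size ws),
    {in us & W, forall u y, ~~ adj u y} & matched_order r 0 ws].
Proof.
have [n] := ubnP (size W); elim: n W => // n IH [|x W] /=.
  by move=> _ _ _; exists [::], [::]; split=> // x0 i j; rewrite andbF.
rewrite ltnS => lt_n /andP[xW uW] deg1.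
case: (boolP (has (adj x) W)) => [/hasP[y yW xy]|/hasPn nx]; last first.
  have [|us [ws [pW ev iso_us mo]]] := IH W lt_n uW.
    by move=> a b c aW bW cW; apply: deg1; rewrite inE ?aW ?bW ?cW orbT.
  exists (x :: us), ws; split=> //=; first by rewrite perm_cons.
  move=> u z; rewrite !inE => /predU1P[->|uus] /predU1P[->|zW].
  - by rewrite adj_irrefl.
  - exact: nx.
  - by rewrite adj_sym nx // -(perm_mem pW) mem_cat uus.
  - exact: iso_us.
have yW' z : z \in rem y W -> (z != y) && (z \in W) by rewrite (mem_rem_uniq _ uW) inE.
have [||us [ws [pW ev iso_us mo]]] := IH (rem y W) _ (rem_uniq _ uW).
- by rewrite size_rem // (leq_ltn_trans (leq_pred _) lt_n).
- by move=> a b c /yW'/andP[_ aW] /yW'/andP[_ bW] /yW'/andP[_ cW];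
    apply: deg1; rewrite inE ?aW ?bW ?cW orbT.
have nxz z : z \in rem y W -> ~~ adj x z.
  move=> /yW'/andP[zy zW]; apply: contra zy => xz; apply/eqP.
  by apply: (deg1 x) => //; rewrite ?mem_head // inE ?zW ?yW orbT.
have nyz z : z \in rem y W -> ~~ adj y z.
  move=> /yW'/andP[_ zW]; apply: contra xW => yz.
  suff -> : x = z by [].
  by apply: (deg1 y) => //; rewrite ?mem_head ?inE ?zW ?yW ?orbT // adj_sym.
have mem_ws z : z \in ws -> z \in rem y W by rewrite -(perm_mem pW) mem_cat orbC => ->.
(* (a, b) is the edge xy, directed so that the rows increase. *)
have [a [b [pab ab lab na nb']]] : exists a b, [/\ perm_eq [:: a; b] [:: x; y], adj a b,
    lerow (r a) (r b), {in ws, forall z, ~~ adj a z} & {in ws, forall z, ~~ adj b z}].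
  case/orP: (lerow_total (r x) (r y)) => le_xy; [exists x, y | exists y, x]; split=> //.
  - by move=> z /mem_ws/nxz.
  - by move=> z /mem_ws/nyz.
  - by rewrite (perm_catC [:: y] [:: x]).
  - by rewrite adj_sym.
  - by move=> z /mem_ws/nyz.
  - by move=> z /mem_ws/nxz.
exists us, (a :: b :: ws); split.
- apply: (@perm_trans _ ([:: x; y] ++ rem y W)).
    by rewrite -[a :: b :: ws]/([:: a; b] ++ ws) perm_catCA perm_cat.
  by rewrite perm_cons perm_sym perm_to_rem.
- by rewrite /= negbK.
- move=> u z uus; have uW' : u \in rem y W by rewrite -(perm_mem pW) mem_cat uus.
  rewrite inE => /predU1P[->|zW]; first by rewrite adj_sym nxz.
  case: (eqVneq z y) => [->|zy]; first by rewrite adj_sym nyz.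
  by apply: iso_us => //; rewrite mem_rem_uniq // inE zy.
- move=> x0 [|[|i]] [|[|j]] //=; rewrite ?ltnS ?andbF // => lt_ij.
  + by rewrite (negbTE (na _ (mem_nth _ _))).
  + by rewrite (negbTE (nb' _ (mem_nth _ _))) // /mate /= andbF.
  + have := mo x0 i j lt_ij; rewrite ltn0 andbF !orbF.
    by rewrite /mate !subn0 /= !eqSS negbK.
Qed.

Lemma matching_order (r : G -> row) W : uniq W ->
  {in W & &, forall x y z, adj x y -> adj x z -> y = z} ->
  exists iso ws, [/\ perm_eq ws W, iso <= size W, odd iso = odd (size W)
    & matched_order r iso ws].
Proof.
move=> uW deg1; have [us [ws [pW ev iso_us mo]]] := matching_split r uW deg1.
pose us' := sort (relpre r lerow) us.
have sz : size us' = size us by rewrite size_sort.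
exists (size us), (us' ++ ws); split.
- by rewrite (perm_trans _ pW) // perm_cat2r perm_sort.
- by rewrite -(perm_size pW) size_cat leq_addr.
- by rewrite -(perm_size pW) size_cat oddD (negbTE ev) addbF.
have srt : sorted (relpre r lerow) us'.
  by apply: sort_sorted => x y; apply: lerow_total.
move=> x0 i j /andP[lt_ij]; rewrite size_cat sz !nth_cat sz => lt_j.
case: (ltnP i (size us)) => le_i.
  have ii : nth x0 us' i \in us by rewrite -(mem_sort (relpre r lerow)) mem_nth ?sz.
  have jj : (if j < size us then nth x0 us' j else nth x0 ws (j - size us)) \in W.
    rewrite -(perm_mem pW) mem_cat; case: ltnP => le_j.
      by rewrite -(mem_sort (relpre r lerow)) mem_nth ?sz.
    by rewrite mem_nth ?orbT // ltn_subLR.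
  rewrite (negbTE (iso_us _ _ ii jj)) /mate leqNgt le_i /=; split=> // /andP[/eqP Ej lt_j'].
  rewrite lt_j' Ej; move/(sortedP x0): srt; apply.
  by rewrite sz -Ej.
have le_j : size us <= j by rewrite (leq_trans le_i) // ltnW.
rewrite ltnNge le_j /= andbF orbF.
have lt_ij' : i - size us < j - size us < size ws.
  by rewrite ltn_sub2r ?(leq_ltn_trans le_i) //= ltn_subLR.
have [-> le_r] := mo x0 _ _ lt_ij'.
(* Past the isolated vertices, positions are those in ws shifted by [size us]. *)
have E : mate (size us) i j = mate 0 (i - size us) (j - size us).
  by rewrite /mate le_i subn0 -subSn // eqn_sub2rE // leqW.
by rewrite E; split=> // m; apply: le_r; rewrite m.
Qed.

(** Mates w, x share no neighbor in s, since the edge wx already lies in a triangle with v. If w and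
    x are not adjacent, an independent triple of s missed by both would give an independent 5-set,
    and an edge of s seen by both would give a J_4. *)
Lemma nbhd_exts_complete iso v ws s : uniq (v :: ws ++ s) ->
  {in ws, forall w, adj v w} -> {in s, forall x, ~~ adj v x} ->
  {in ws, forall w, size ws <= count (adj w) (v :: ws ++ s)} ->
  no_stable 5 (v :: ws ++ s) ->
  matched_order (fun w => nb s w) iso ws ->
  cd (v :: ws ++ s) \in nbhd_exts iso (size ws) (cd s).
Proof.
rewrite /= mem_cat cat_uniq => /andP[/norP[vws vs] /and3P[uws /hasPn dis us]].
move=> vw nvs degw ns mo; set d := size ws.
have wsP x0 i : i < d -> nth x0 ws i \in ws by move=> lt_i; rewrite mem_nth.
have deg1 w x y : w \in ws -> x \in ws -> y \in ws -> adj w x -> adj w y -> x = y.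
  by move=> wi xi yi wx wy; apply: (dfG (vw _ wi)); rewrite ?vw.
apply/mapP; exists [seq nb s w | w <- ws]; last first.
  congr (_ :: _); last by apply: attach_code => i j x0 lt_ij; rewrite (mo x0 i j lt_ij).1.
  rewrite map_cat size_code /d -(size_map (adj v) ws) -(size_map (adj v) s).
  congr (_ ++ _).
    by apply/all_pred1P; rewrite all_map; apply/allP=> w /vw /= ->.
  by apply/all_pred1P; rewrite all_map; apply/allP=> x /nvs /= /negbTE ->.
apply: csp_complete; rewrite ?size_map ?size_iota //; [move=> k lt_k|move=> k l lt_kl].
  have w0 : G := v; rewrite (nth_map w0) // (nth_map 0) ?size_iota // nth_iota // add0n.
  set w := nth w0 ws k; have win : w \in ws by apply: wsP.
  rewrite mem_filter cands_complete ?andbT //; last first.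
    by apply/negP=> /dis; rewrite /= win.
  (* The degree of w counts v, its neighbors in s and its neighbors in ws; the last are at most one,
     and none at positions below iso. *)
  have := degw _ win; rewrite /= adj_sym (vw _ win) count_cat add1n -/d => le_d.
  rewrite (leq_trans le_d) // addSn ltnS addnC count_map leq_add2l.
  case: (leqP iso k) => [_|lt_i].
    have uf : uniq [seq x <- ws | adj w x] by rewrite filter_uniq.
    rewrite -size_filter; move: uf; have := fun x => mem_filter (adj w) x ws.
    move: [seq x <- ws | adj w x] => [|x [|y q]] memf //=;
      rewrite inE negb_or => /andP[/andP[/eqP[]]].
    have := memf x; rewrite mem_head => /esym/andP[wx xi].
    have := memf y; rewrite inE mem_head orbT => /esym/andP[wy yi].
    exact: (deg1 w).
  rewrite leqn0 eqn0Ngt -has_count; apply/hasPn => x /(nthP w0)[j lt_j <-].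
  rewrite /w; case: (ltngtP k j) => [lt_kj|lt_jk|->]; last by rewrite adj_irrefl.
    by rewrite (mo w0 k j _).1 ?lt_kj // /mate leqNgt lt_i.
  rewrite adj_sym (mo w0 j k _).1 ?lt_jk // /mate leqNgt.
  by rewrite (ltn_trans lt_jk).
have [lt_kl' lt_l] := andP lt_kl; have lt_k := ltn_trans lt_kl' lt_l.
have w0 : G := v; rewrite !add0n !(nth_map w0) //.
have [adj_kl le_kl] := mo w0 k l lt_kl.
set w := nth w0 ws k in adj_kl le_kl *; set x := nth w0 ws l in adj_kl le_kl *.
have win : w \in ws by apply: wsP.
have xin : x \in ws by apply: wsP.
have wx : w != x by rewrite nth_uniq // neq_ltn lt_kl'.
rewrite /nb_test; case: ifP adj_kl le_kl => _ wx_adj le_kl.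
  rewrite le_kl //= meets_map; apply/hasPn => z zs; apply/negP=> /andP[wz xz].
  have E : v = z by apply: (dfG wx_adj); rewrite // adj_sym vw.
  by rewrite E zs in vs.
rewrite -andbA; apply/and3P; split; first by case: ifP => // m; apply: le_kl; rewrite m.
  apply/allP=> m; rewrite mem_filter !meets_mask => /andP[nw min].
  rewrite meetsC meets_mask; apply/negPn/negP=> nx.
  have [st sz] := indep_sound us min.
  apply: (ns (w :: x :: mask m s)); last by rewrite /= sz.
  - rewrite /= inE negb_or wx mask_uniq // andbT -andbA /=.
    by apply/andP; split; apply/negP=> /mem_mask/dis; rewrite /= ?win ?xin.
  - move=> z; rewrite !inE mem_cat => /or3P[/eqP->|/eqP->|/mem_mask->];
      by rewrite ?win ?xin ?orbT.
  - by rewrite !stable_cons /= st wx_adj nw nx.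
exact: (compat_nb dfG).
Qed.

End Neighborhoods.

(** * The classification *)

(* The maximal J_4-free graph, with 45 edges; the other four graphs are obtained
   from it by deleting the edges in removed. *)
Definition upper_nbrs : seq (seq nat) :=
  [:: [:: 9; 10; 11; 12; 13; 14]; [:: 7; 8; 11; 12; 13; 14];
      [:: 5; 6; 10; 12; 13; 14]; [:: 4; 6; 8; 11; 12; 14]; [:: 5; 7; 10; 12; 13];
      [:: 8; 9; 11; 14]; [:: 7; 9; 11; 13]; [:: 9; 10; 14]; [:: 9; 10; 13];
      [:: 12]; [:: 11]].

Definition removed : seq (seq (nat * nat)) :=
  [:: [:: (0, 12); (5, 8)]; [:: (0, 12); (3, 11); (4, 10)]; [:: (0, 12); (3, 11)];
      [:: (0, 12)]; [::]].

Definition link k : rel nat := fun i j =>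
  let up i j := [&& i < j, j \in nth [::] upper_nbrs i
                  & (i, j) \notin nth [::] removed k] in
  up i j || up j i.

Definition target k := code (link k) (iota 0 15).

Definition is_target T := has (same (wcode_of T)) [seq wcode_of (target k) | k <- iota 0 5].

Definition nbhds_ok d (L : seq (seq row)) :=
  let tg := [seq wcode_of (target k) | k <- iota 0 5] in
  all (fun iso => all (fun T => all
      (fun T' => if has (same (wcode_of T')) tg then true else some_col 4 T')
      (nbhd_exts iso d T)) L)
    [seq iso <- iota 0 d.+1 | odd iso == odd d].

(** For [gen 4 8] and [gen 7 6]; the latter covers all J_4-free graphs on 6 vertices, which have no
    room for an independent 7-set. The first conjunct excludes 11 vertices without an independent
    4-set. A vertex of degree 4, 5 or 6 has 10, 9 or 8 non-neighbors, whence the last three. *)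
Definition search_ok (L8 K6 : seq (seq row)) : bool :=
  let L9 := step 4 L8 in
  let L10 := step 4 L9 in
  [&& nilp (step 4 L10),
      all is_target (stable_exts 4 5 (L10 ++ stable_exts 3 4 K6)),
      nbhds_ok 4 L10, nbhds_ok 5 L9 & nbhds_ok 6 L8].

Lemma search_succeeds : search_ok (gen 4 8) (gen 7 6).
Proof. by vm_compute. Qed.

Lemma nbhds_okP d L iso T T' : nbhds_ok d L -> iso <= d -> odd iso = odd d ->
  T \in L -> T' \in nbhd_exts iso d T -> is_target T' || some_col 4 T'.
Proof.
move=> /allP H le_iso ev TL T'in; have /H/allP/(_ T TL)/allP/(_ T' T'in) :
    iso \in [seq iso <- iota 0 d.+1 | odd iso == odd d].
  by rewrite mem_filter ev eqxx mem_iota.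
by rewrite /is_target; case: (has _ _).
Qed.

(* Stated for a variable n: on numerals, unification would run the search. *)
Lemma search_okP n K : search_ok (gen 4 n) K ->
  [/\ gen 4 n.+3 = [::],
      {in stable_exts 4 5 (gen 4 n.+2 ++ stable_exts 3 4 K), forall T, is_target T}
    & [/\ nbhds_ok 4 (gen 4 n.+2), nbhds_ok 5 (gen 4 n.+1) & nbhds_ok 6 (gen 4 n)]].
Proof. by case/and5P=> /nilP ? /allP. Qed.

Lemma nbhds_facts d iso T T' : 4 <= d <= 6 -> iso <= d -> odd iso = odd d ->
  T \in gen 4 (14 - d) -> T' \in nbhd_exts iso d T -> is_target T' || some_col 4 T'.
Proof.
have [_ _ [n4 n5 n6]] := search_okP search_succeeds.
move=> d46; have: [|| d == 4, d == 5 | d == 6].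
  by case: d d46 => [|[|[|[|[|[|[|d]]]]]]].
case/or3P=> /eqP-> le_iso odd_iso.
- exact (nbhds_okP n4 le_iso odd_iso).
- exact (nbhds_okP n5 le_iso odd_iso).
- exact (nbhds_okP n6 le_iso odd_iso).
Qed.

(** With [gen_complete], this bounds the Ramsey number of J_4 against K_4 by 11. *)
Lemma gen_4_11 T : T \notin gen 4 11.
Proof. by have [-> _ _] := search_okP search_succeeds. Qed.

(** * Every graph in question has one of the five target codes *)

Section Classification.

Variable G : sgraph.
Hypothesis dfG : diamond_free G.

Local Notation nb s x := (map (adj (x : G)) s).
Local Notation cd := (code (@adj G)).
Local Notation enumG := (enum G).

Lemma is_targetP s : is_target (cd s) -> exists2 k, k < 5 &
  exists2 s', perm_eq s' s & cd s' = target k.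
Proof.
rewrite /is_target; have : all (gtn 5) (iota 0 5) by [].
elim: (iota 0 5) => //= k l IH /andP[lt_k lt_l] /orP[/same_sound[s' ps' E]|]; last exact: IH.
by exists k => //; exists s'.
Qed.

Lemma colorable_perm k (l l' : seq G) : perm_eq l l' -> colorable k l -> colorable k l'.
Proof. by move=> p; apply: colorable_sub => x; rewrite (perm_mem p). Qed.

Lemma colorable_stable k (t l : seq G) : stable t -> colorable k l -> colorable k.+1 (t ++ l).
Proof.
move=> /stableP st [c [ck cp]]; exists (fun x => if x \in t then k else c x).
have cl x : x \in t ++ l -> (x \in t) = false -> x \in l.
  by rewrite mem_cat => /orP[->|].
split=> [x xin|x y xin yin xy].
  by case: ifP => // /(cl _ xin)/ck; apply: leqW.
case: ifP => xt; case: ifP => yt.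
- by have := st _ _ xt yt; rewrite xy.
- by rewrite neq_ltn ck ?orbT // cl.
- by rewrite neq_ltn ck // cl.
- by apply: cp => //; apply: cl.
Qed.

Lemma split_off (t s : seq G) : uniq t -> uniq s -> {subset t <= s} ->
  perm_eq (t ++ [seq x <- s | x \notin t]) s.
Proof.
move=> ut us sub; apply: uniq_perm => //.
  rewrite cat_uniq ut filter_uniq // andbT; apply/hasPn => x.
  by rewrite mem_filter => /andP[].
move=> x; rewrite mem_cat mem_filter; case: (boolP (x \in t)) => //= xt.
by rewrite sub.
Qed.

Definition has_stable k (s : seq G) :=
  [exists t : k.-tuple G, [&& uniq t, all (mem s) t & stable t]].

Lemma has_stableP k s : has_stable k s -> exists t,
  [/\ uniq t, {subset t <= s}, stable t & size t = k].
Proof.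
case/existsP=> t /and3P[ut /allP ts st]; exists t; split=> //.
by rewrite size_tuple.
Qed.

Lemma not_has_stable k s : ~~ has_stable k s -> no_stable k s.
Proof.
move=> ns t ut ts st sz; case/negP: ns; apply/existsP.
have tP : size t == k by apply/eqP.
by exists (Tuple tP); rewrite /= ut st andbT; apply/allP.
Qed.

Lemma no_stable_sub k (s s' : seq G) : {subset s' <= s} -> no_stable k s -> no_stable k s'.
Proof. by move=> sub ns t ut ts; apply: ns => // x /ts/sub. Qed.

Lemma count_sum (p : pred G) s : count p s = \sum_(x <- s) p x.
Proof. by elim: s => [|x s IH] /=; rewrite ?big_nil // big_cons IH. Qed.

(** A vertex outside the triangle is adjacent to at most one of its vertices, and each of x, y, z to
    exactly two. So every vertex contributes at most 1 to the sum, plus 1 more for x, y and z. *)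
Lemma triangle_degrees x y z : adj x y -> adj x z -> adj y z ->
  count (adj x) enumG + count (adj y) enumG + count (adj z) enumG <= #|G| + 3.
Proof.
move=> xy xz yz; have one a : count (pred1 a) enumG = 1.
  by rewrite (count_uniq_mem _ (enum_uniq G)) mem_enum.
have -> : #|G| + 3 = count predT enumG + count (pred1 x) enumG
    + count (pred1 y) enumG + count (pred1 z) enumG.
  by rewrite !one count_predT -cardE !addn1 addn3.
rewrite !count_sum -!big_split /=; apply: leq_sum => w _.
have yx : adj y x by rewrite adj_sym.
have zx : adj z x by rewrite adj_sym.
have zy : adj z y by rewrite adj_sym.
have nxy : adj x w -> adj y w -> w = z by move=> xw yw; apply: (dfG xy).
have nxz : adj x w -> adj z w -> w = y by move=> xw zw; apply: (dfG xz).
have nyz : adj y w -> adj z w -> w = x by move=> yw zw; apply: (dfG yz).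
case: (eqVneq w x) nyz => [->|/eqP wx] nyz; first by rewrite adj_irrefl; do 2!case: (adj _ _).
case: (eqVneq w y) nxz => [->|/eqP wy] nxz; first by rewrite adj_irrefl; do 2!case: (adj _ _).
case: (eqVneq w z) nxy => [->|/eqP wz] nxy; first by rewrite adj_irrefl; do 2!case: (adj _ _).
case: (adj x w) (adj y w) (adj z w) nxy nxz nyz => [] [] [] //= nxy nxz nyz.
all: by [case: wz; apply: nxy | case: wy; apply: nxz | case: wx; apply: nyz].
Qed.

Hypothesis card_G : #|G| = 15.
Hypothesis ncol : ~ colorable 4 enumG.

Lemma classify_large_stable : has_stable 5 enumG -> exists2 k, k < 5 &
  exists2 s, perm_eq s enumG & cd s = target k.
Proof.
(* L hides the computed list of the graphs that may remain on 10 vertices. *)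
have [L [inL1 inL2 leafA]] : exists L, [/\ {subset gen 4 10 <= L},
    {subset stable_exts 3 4 (gen 7 6) <= L}
  & {in stable_exts 4 5 L, forall T, is_target T}].
  have [_ leafA _] := search_okP search_succeeds; eexists; split; last exact: leafA.
    by move=> T TL; rewrite mem_cat; apply/orP; left; exact: TL.
  by move=> T TL; rewrite mem_cat; apply/orP; right; exact: TL.
case/has_stableP=> t [ut tG st sz_t]; set H := [seq x <- enumG | x \notin t].
have pH : perm_eq (t ++ H) enumG by apply: split_off; rewrite ?enum_uniq.
have szH : size H = 10.
  apply/eqP; rewrite -(eqn_add2l 5) -{1}sz_t -size_cat (perm_size pH).
  by rewrite -cardE card_G.
have uH : uniq H by rewrite filter_uniq ?enum_uniq.
(* The stable set t would take a fourth color. *)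
have ncolH : ~ colorable 3 H.
  by move=> /(colorable_stable st)/(colorable_perm pH).
have [s10 p10 in10] : exists2 s, perm_eq s H & cd s \in L.
  case: (boolP (has_stable 4 H)) => [/has_stableP[t4 [ut4 t4H st4 sz4]]|/not_has_stable ns].
    set K := [seq x <- H | x \notin t4].
    have pK : perm_eq (t4 ++ K) H by apply: split_off.
    have szK : size K = 6.
      by apply/eqP; rewrite -(eqn_add2l 4) -{1}sz4 -size_cat (perm_size pK) szH.
    have uK : uniq K by rewrite filter_uniq.
    (* The bound 7 is vacuous on the 6 vertices of K. *)
    have [//|//||s6 p6 in6] := @gen_complete G 7 K dfG.
      by move=> q uq qK _ szq; have := uniq_leq_size uq qK; rewrite szq szK.
    have p46 : perm_eq (t4 ++ s6) H by rewrite (perm_trans _ pK) // perm_cat2l.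
    rewrite szK in in6.
    have [|//|//||//|s ps s_in] := @stable_exts_complete G dfG 3 4 (gen 7 6) s6 t4.
    - by rewrite (perm_uniq p46).
    - by apply: contra_not ncolH; apply: colorable_perm.
    by exists s; [exact: perm_trans ps p46 | exact: inL2].
  have [//|//|//|s ps s_in] := @gen_complete G 4 H dfG.
  by rewrite szH in s_in; exists s; [exact: ps | exact: inL1].
have pt10 : perm_eq (t ++ s10) enumG by rewrite (perm_trans _ pH) // perm_cat2l.
have [||s ps s_in] := @stable_exts_complete G dfG 4 5 _ s10 t _ st sz_t _ in10.
- by rewrite (perm_uniq pt10) enum_uniq.
- by move=> /(colorable_perm pt10).
have [k lt_k [s' ps' E]] := is_targetP (leafA _ s_in).
by exists k => //; exists s' => //; rewrite (perm_trans ps') // (perm_trans ps).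
Qed.

Lemma some_col_colorable k s : uniq s -> some_col k (cd s) -> colorable k s.
Proof.
move=> us H; have [|f [fk fp _]] :=
    search_col_sound (k := k) (@adj_sym G) (@adj_irrefl G) us _ H; last by exists f.
by move=> c a; rewrite mem_iota add0n => /leq_trans; apply; apply: geq_minl.
Qed.

Lemma classify_no_stable : ~~ has_stable 5 enumG -> exists2 k, k < 5 &
  exists2 s, perm_eq s enumG & cd s = target k.
Proof.
move/not_has_stable=> ns5.
have /card_gt0P[v0 _] : 0 < #|G| by rewrite card_G.
have [v _ min_v] := arg_minnP (fun v => count (adj v) enumG) (isT : predT v0).
set d := count (adj v) enumG in min_v.
pose W := [seq w <- enumG | adj v w].
pose H := [seq x <- enumG | (x != v) && ~~ adj v x].
have uW : uniq W by rewrite filter_uniq ?enum_uniq.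
have uH : uniq H by rewrite filter_uniq ?enum_uniq.
have szW : size W = d by rewrite size_filter.
have memW w : (w \in W) = adj v w by rewrite mem_filter mem_enum andbT.
have memH x : (x \in H) = (x != v) && ~~ adj v x by rewrite mem_filter mem_enum andbT.
have pG : perm_eq (v :: W ++ H) enumG.
  apply: uniq_perm; rewrite ?enum_uniq //=.
    rewrite mem_cat memW memH eqxx adj_irrefl /= cat_uniq uW uH andbT.
    by apply/hasPn=> x; rewrite memH /= memW => /andP[].
  move=> x; rewrite inE mem_cat memW memH mem_enum.
  by case: eqP => //=; case: adj.
have szH : size H = 14 - d.
  have := perm_size pG; rewrite -cardE card_G /= size_cat szW => -[E].
  by rewrite -E addKn.
have nsH : no_stable 4 H.
  move=> t ut tH st szt; apply: (ns5 (v :: t)); last by rewrite /= szt.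
  - by rewrite /= ut andbT; apply/negP => /tH; rewrite memH eqxx.
  - by move=> x _; rewrite mem_enum.
  - rewrite stable_cons st andbT; apply/hasPn => x /tH.
    by rewrite memH => /andP[].
(* For d < 4, H would contain 11 vertices without an independent 4-set. *)
have d_ge4 : 4 <= d.
  rewrite leqNgt; apply/negP=> lt_d.
  have sub11 : {subset take 11 H <= H} by move=> x; apply: mem_take.
  have sz11 : size (take 11 H) = 11.
    by rewrite size_takel // szH; case: (d) lt_d => [|[|[|[|]]]].
  have [//|||s _] := @gen_complete G 4 (take 11 H) dfG.
  - exact: take_uniq.
  - exact: no_stable_sub nsH.
  - by rewrite sz11; apply/negP; apply: gen_4_11.
(* If d >= 7, then N(v) contains an edge, and a triangle all of whose degrees
   are at least 7 contradicts triangle_degrees. *)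
have d_le6 : d <= 6.
  rewrite leqNgt; apply/negP=> lt_d.
  have : ~~ stable (take 5 W).
    apply/negP=> st; apply: (ns5 (take 5 W)); rewrite ?take_uniq //.
      by move=> x _; rewrite mem_enum.
    by rewrite size_takel // szW ltnW // ltnW.
  case/allPn=> a /mem_take; rewrite memW => va /allPn[b /mem_take].
  rewrite memW negbK => vb ab.
  have := triangle_degrees va vb ab; rewrite card_G leqNgt => /negP; apply.
  have := min_v a isT; have := min_v b isT; rewrite -/d => db da.
  apply: leq_trans (leq_add (leq_add (leqnn d) da) db).
  by apply: leq_trans (leq_add (leq_add lt_d lt_d) lt_d).
have [//|//|//|s ps s_in] := @gen_complete G 4 H dfG.
rewrite szH in s_in.
have [iso [ws [pws le_iso odd_iso mo]]] : exists iso ws, [/\ perm_eq ws W, iso <= size W,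
    odd iso = odd (size W) & matched_order (fun w => nb s w) iso ws].
  apply: matching_order => // x y z; rewrite !memW => vx vy vz xy xz.
  exact: (dfG vx).
have pG' : perm_eq (v :: ws ++ s) enumG.
  by rewrite (perm_trans _ pG) // perm_cons perm_cat.
have szws : size ws = d by rewrite (perm_size pws).
have := @nbhd_exts_complete G dfG iso v ws s.
rewrite (perm_uniq pG') enum_uniq szws => /(_ isT) nbhd.
have /(@nbhds_facts d iso (cd s)) : cd (v :: ws ++ s) \in nbhd_exts iso d (cd s).
  apply: nbhd => //.
  - by move=> w; rewrite (perm_mem pws) memW.
  - by move=> x; rewrite (perm_mem ps) memH => /andP[].
  - by move=> w _; rewrite (permP pG') min_v.
  - by apply: no_stable_sub ns5 => x _; rewrite mem_enum.
rewrite d_ge4 d_le6 -szW => /(_ isT le_iso odd_iso); rewrite szW => /(_ s_in).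
case/orP=> [/is_targetP[k lt_k [s' ps' E]]|/some_col_colorable C].
  by exists k => //; exists s' => //; rewrite (perm_trans ps').
by case: ncol; apply: colorable_perm (C _); rewrite // (perm_uniq pG') enum_uniq.
Qed.

Lemma classification : exists2 k, k < 5 & exists2 s, perm_eq s enumG & cd s = target k.
Proof.
by case: (boolP (has_stable 5 enumG)) => [/classify_large_stable|/classify_no_stable].
Qed.

End Classification.

(** * The five graphs *)

Definition has_diamond (T : seq row) : bool :=
  let F := full T in
  ~~ all (fun r => all (fun p => if p.1 then atmost1 (band r p.2) else true) (zip r F)) F.

Definition same_pair (i j i0 j0 : nat) : bool :=
  (i == i0) && (j == j0) || (i == j0) && (j == i0).

Lemma same_pairC i j i0 j0 : same_pair i j i0 j0 = same_pair i j j0 i0.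
Proof. by rewrite /same_pair orbC. Qed.

Definition add_code k i0 j0 :=
  code (fun i j => link k i j || same_pair i j i0 j0) (iota 0 15).

Definition del_code k i0 j0 :=
  code (fun i j => link k i j && ~~ same_pair i j i0 j0) (iota 0 15).

Lemma add_codeC k i j : add_code k i j = add_code k j i.
Proof.
rewrite /add_code; elim: (iota 0 15) => //= a l ->; congr (_ :: _).
by apply: eq_map => b; rewrite same_pairC.
Qed.

Lemma del_codeC k i j : del_code k i j = del_code k j i.
Proof.
rewrite /del_code; elim: (iota 0 15) => //= a l ->; congr (_ :: _).
by apply: eq_map => b; rewrite same_pairC.
Qed.

Definition all_pairs (p : nat -> nat -> bool) : bool :=
  all (fun i => all (fun j => if i < j then p i j else true) (iota 0 15)) (iota 0 15).

Definition maximal_test k :=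
  all_pairs (fun i j => if link k i j then true else has_diamond (add_code k i j)).

Definition minimal_test k :=
  all_pairs (fun i j => if link k i j then any_col 4 (del_code k i j) else true).

(* An isomorphism invariant that separates the five graphs; neither the number
   of edges nor the number of triangles does. *)
Definition codegree_energy (T : seq row) : nat :=
  let F := full T in
  sumn [seq sumn [seq (let c := count id (band r q) in c * c) | q <- F] | r <- F].

(** The third conjunct says that no target has an isolated vertex, which rules out padded smaller
    graphs. *)
Definition targets_ok : bool :=
  let ks := iota 0 5 in
  [&& all (fun k => ~~ has_diamond (target k)) ks,
      all (fun k => ~~ any_col 4 (target k)) ks,
      all (fun k => all (has id) (full (target k))) ks,
      uniq [seq codegree_energy (target k) | k <- ks],
      all (fun k => maximal_test k == (k == 4)) ks
    & all (fun k => minimal_test k == (k < 2)) ks].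

Lemma targets_okT : targets_ok.
Proof. by vm_compute. Qed.

Lemma link_sym k : symmetric (link k).
Proof. by move=> i j; rewrite /link orbC. Qed.

Lemma link_irrefl k : irreflexive (link k).
Proof. by move=> i; rewrite /link ltnn. Qed.

Definition target_graph k : sgraph :=
  @SGraph 'I_15 (fun x y => link k x y) (fun x y => link_sym k x y)
    (fun x => link_irrefl k x).

Definition represents (G : sgraph) k :=
  exists2 s, perm_eq s (enum G) & code (@adj G) s = target k.

Lemma size_target k : size (target k) = 15.
Proof. by rewrite size_code size_iota. Qed.

Lemma target_graph_represents k : represents (target_graph k) k.
Proof.
exists (enum 'I_15) => //; rewrite /target -val_enum_ord.
by symmetry; apply: code_map.
Qed.

Lemma all_pairsP (p : nat -> nat -> bool) : reflect (forall i j, i < j < 15 -> p i j) (all_pairs p).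
Proof.
apply: (iffP allP) => [H i j /andP[lt_ij lt_j]|H i].
  have lt_i := ltn_trans lt_ij lt_j.
  have := H i; rewrite mem_iota => /(_ lt_i)/allP/(_ j).
  by rewrite mem_iota lt_ij; apply.
rewrite mem_iota => lt_i; apply/allP => j; rewrite mem_iota => lt_j.
by case: ifP => // lt_ij; apply: H; rewrite lt_ij.
Qed.

(** * Boolean tests for J_4 and for arrowing *)

Section Diamonds.

Variable G : sgraph.

Definition diamond := [exists x : G, exists y : G, exists a : G, exists b : G,
  [&& adj x y, adj x a, adj y a, adj x b, adj y b & a != b]].

Lemma diamond_freeP : diamond_free G <-> ~~ diamond.
Proof.
split=> [H|/negP H x y a b xy xa ya xb yb].
  apply/negP=> /existsP[x /existsP[y /existsP[a /existsP[b /andP[xy /and5P[]]]]]].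
  by move=> xa ya xb yb; rewrite (H x y a b) ?eqxx.
apply/eqP/negPn/negP=> ab; apply: H.
apply/existsP; exists x; apply/existsP; exists y; apply/existsP; exists a.
by apply/existsP; exists b; rewrite xy xa ya xb yb ab.
Qed.

Lemma diamondP : has_subgraph (J 4) G <-> diamond.
Proof.
split=> [[f [injf adjf]]|/existsP[x /existsP[y /existsP[a /existsP[b /andP[xy /and5P[]]]]]]].
  pose o k (lt_k : k < 4) : J 4 := Ordinal lt_k.
  (* The missing edge of [J 4] is {0, 1}, so 2 and 3 span the edge common to both triangles. *)
  apply/existsP; exists (f (@o 2 isT)); apply/existsP; exists (f (@o 3 isT)).
  apply/existsP; exists (f (@o 0 isT)); apply/existsP; exists (f (@o 1 isT)).
  by rewrite !adjf // (inj_eq injf).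
move=> xa ya xb yb ab; exists (fun i : 'I_4 => nth x [:: a; b; x; y] i).
have neq u w : adj u w -> (u == w) = false.
  by move=> uw; apply/eqP=> E; rewrite E adj_irrefl in uw.
split=> [i j E|].
  apply/val_inj/eqP; rewrite -(@nth_uniq _ x [:: a; b; x; y]) ?ltn_ord ?E //.
  rewrite /= !inE (negbTE ab) !(eq_sym a) !(eq_sym b) !neq //.
have [yx ax ay bx b_y] : [/\ adj y x, adj a x, adj a y, adj b x & adj b y].
  by rewrite ![adj _ x]adj_sym ![adj _ y]adj_sym [adj y x]adj_sym.
by move=> [[|[|[|[|i]]]] lt_i] [[|[|[|[|j]]]] lt_j].
Qed.

Lemma has_diamondE s : perm_eq s (enum G) -> has_diamond (code (@adj G) s) = diamond.
Proof.
move=> ps; have us : uniq s by rewrite (perm_uniq ps) enum_uniq.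
have sG x : x \in s by rewrite (perm_mem ps) mem_enum.
apply: negb_inj; rewrite /has_diamond negbK full_cd.
have zipE (f : G -> bool) (g : G -> row) t :
    zip (map f t) (map g t) = map (fun x => (f x, g x)) t.
  by elim: t => //= x t ->.
apply/allP/idP => [H|/diamond_freeP H r /mapP[x _ ->]].
  apply/diamond_freeP=> x y a b xy xa ya xb yb.
  have /H : [seq adj x z | z <- s] \in [seq [seq adj x z | z <- s] | x <- s].
    by apply: (map_f (fun x => map (adj x) s)).
  rewrite zipE all_map => /allP/(_ y (sG y)) /=; rewrite xy band_map.
  by move/(atmost1_mapP _ us)/(_ a b (sG a) (sG b)); rewrite xa ya xb yb; apply.
rewrite zipE all_map; apply/allP=> y _ /=; case: ifP => // xy.
rewrite band_map; apply/atmost1_mapP=> // a b _ _ /andP[xa ya] /andP[xb yb].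
exact: (H x y).
Qed.

(** All entries being 2, a clique of one color is a monochromatic edge. *)
Lemma arrows_colorable : arrows G [:: 2; 2; 2; 2] <-> ~ colorable 4 (enum G).
Proof.
have en (x : G) : x \in enum G by rewrite mem_enum.
split=> [H [c [ck cp]]|H c].
  have [i [A [clA cardA colA]]] := H (fun x => inord (c x)).
  have {cardA} /cards2P[x [y [nxy EA]]] : #|A| == 2.
    by rewrite cardA; case: (i) => [[|[|[|[|n]]]] lt_n].
  have xA : x \in A by rewrite EA !inE eqxx.
  have yA : y \in A by rewrite EA !inE eqxx orbT.
  have /negP[] := cp x y (en x) (en y) (clA _ _ xA yA nxy).
  have := congr1 val (colA x xA); have := congr1 val (colA y yA).
  by rewrite /= !inordK ?ck // => -> ->.
case: (boolP [exists x : G, exists y : G, adj x y && (c x == c y)]).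
  case/existsP=> x /existsP[y /andP[xy /eqP E]]; exists (c x), [set x; y]; split.
  - move=> u w; rewrite !inE => /orP[]/eqP-> /orP[]/eqP->; rewrite ?eqxx //.
    by rewrite adj_sym.
  - rewrite cards2; have -> /= : x != y.
      by apply/eqP=> Exy; rewrite Exy adj_irrefl in xy.
    by case: (c x) => [[|[|[|[|i]]]]].
  - by move=> u; rewrite !inE => /orP[]/eqP->.
rewrite negb_exists => /forallP nc; case: H; exists (fun x => c x); split.
  by move=> x _; apply: ltn_ord.
move=> x y _ _ xy; apply/negP=> /eqP E; have := nc x; rewrite negb_exists.
by move/forallP/(_ y); rewrite xy (val_inj E) eqxx.
Qed.

Lemma any_col_colorable s : perm_eq s (enum G) ->
  any_col 4 (code (@adj G) s) <-> colorable 4 (enum G).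
Proof.
move=> ps; have us : uniq s by rewrite (perm_uniq ps) enum_uniq.
split=> [H|/(colorable_perm (_ : perm_eq (enum G) s))].
  have [|f [fk fp _]] :=
    search_col_sound (k := 4) (@adj_sym G) (@adj_irrefl G) us _ H.
    by move=> _ a; rewrite mem_iota.
  by apply: (colorable_perm ps); exists f.
rewrite perm_sym => /(_ ps) [f [fk fp]].
exact: search_col_complete fk fp us (@adj_irrefl G) _.
Qed.

End Diamonds.

Lemma set2_eq (A : finType) (x y u v : A) : u != v ->
  ([set x; y] == [set u; v]) = (x == u) && (y == v) || (x == v) && (y == u).
Proof.
move=> uv; apply/eqP/orP => [E|]; last first.
  by case=> /andP[/eqP-> /eqP->] //; rewrite setUC.
have : u \in [set x; y] by rewrite E !inE eqxx.
have : v \in [set x; y] by rewrite E !inE eqxx orbT.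
have : x \in [set u; v] by rewrite -E !inE eqxx.
have : y \in [set u; v] by rewrite -E !inE eqxx orbT.
rewrite !inE (eq_sym u x) (eq_sym u y) (eq_sym v x) (eq_sym v y).
case: (eqVneq x u) => [->|_] /=; first by rewrite (negbTE uv) /= => _ _ ->; left.
by move=> _ -> /= _ ->; right.
Qed.

(** * Properties read off a target code *)

Section Represented.

Variables (G : sgraph) (k : nat) (s : seq G).
Hypotheses (lt_k : k < 5) (ps : perm_eq s (enum G)) (Es : code (@adj G) s = target k).

Lemma size_repr : size s = 15.
Proof. by rewrite -(size_code (@adj G)) Es size_target. Qed.

Lemma card_repr : #|G| = 15.
Proof. by rewrite cardE -(perm_size ps) size_repr. Qed.

Let x0 : G.
Proof. by case: s size_repr. Qed.

Let us : uniq s. Proof. by rewrite (perm_uniq ps) enum_uniq. Qed.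

Let sG x : x \in s. Proof. by rewrite (perm_mem ps) mem_enum. Qed.

Lemma adj_nth (d : G) i j : i < 15 -> j < 15 -> adj (nth d s i) (nth d s j) = link k i j.
Proof.
have Eiota : code (@adj G) s = code (link k) (iota 0 (size s)) by rewrite Es size_repr.
have H : forall i j, i < j < 15 -> adj (nth d s i) (nth d s j) = link k i j.
  by rewrite -size_repr; apply/code_iotaP.
move=> lt_i lt_j; case: (ltngtP i j) => [lt_ij|lt_ji|->].
- by rewrite H // lt_ij.
- by rewrite adj_sym link_sym H // lt_ji.
- by rewrite adj_irrefl link_irrefl.
Qed.

Lemma code_changed (e : rel G) (e' : rel nat) :
  (forall i j, i < 15 -> j < 15 -> i != j -> e (nth x0 s i) (nth x0 s j) = e' i j) ->
  code e s = code e' (iota 0 15).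
Proof.
move=> H; rewrite -size_repr; apply/(code_iotaP _ _ x0) => i j.
rewrite size_repr => /andP[lt_ij lt_j].
by rewrite H // ?(ltn_trans lt_ij) // neq_ltn lt_ij.
Qed.

Lemma same_pair_nth i j i0 j0 : i < 15 -> j < 15 -> i0 < 15 -> j0 < 15 -> i0 != j0 ->
  ([set nth x0 s i; nth x0 s j] == [set nth x0 s i0; nth x0 s j0]) = same_pair i j i0 j0.
Proof.
move=> lt_i lt_j lt_i0 lt_j0 nij; rewrite set2_eq; last by rewrite nth_uniq ?size_repr.
by rewrite /same_pair !nth_uniq ?size_repr.
Qed.

Lemma code_add_edge i j : i < 15 -> j < 15 -> i != j ->
  code (@adj (add_edge (nth x0 s i) (nth x0 s j))) s = add_code k i j.
Proof.
move=> lt_i lt_j nij; apply: code_changed => a b lt_a lt_b nab.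
rewrite /= /add_adj adj_nth // same_pair_nth //.
by rewrite nth_uniq ?size_repr // nab.
Qed.

Lemma code_del_edge i j : i < 15 -> j < 15 -> i != j ->
  code (@adj (del_edge (nth x0 s i) (nth x0 s j))) s = del_code k i j.
Proof.
move=> lt_i lt_j nij; apply: code_changed => a b lt_a lt_b nab.
by rewrite /= /del_adj adj_nth // same_pair_nth.
Qed.

Lemma lt_index x : index x s < 15.
Proof. by rewrite -size_repr index_mem. Qed.

Lemma repr_free : free (J 4) G.
Proof.
case/and5P: targets_okT => /allP/(_ k) H _ _ _ _.
move/diamondP; rewrite -(has_diamondE ps) Es; apply/negP; apply: H.
by rewrite mem_iota.
Qed.

Lemma repr_arrows : arrows G [:: 2; 2; 2; 2].
Proof.
case/and5P: targets_okT => _ /allP/(_ k) H _ _ _.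
apply/arrows_colorable; move/(any_col_colorable ps); rewrite Es; apply/negP; apply: H.
by rewrite mem_iota.
Qed.

Lemma repr_maximal : maximal_free (J 4) G <-> k = 4.
Proof.
have -> : k = 4 <-> maximal_test k.
  case/and5P: targets_okT => _ _ _ _ /andP[/allP/(_ k) + _].
  by rewrite mem_iota => /(_ lt_k)/eqP->; split=> /eqP.
split=> [[_ H]|/all_pairsP H].
  apply/all_pairsP=> i j /andP[lt_ij lt_j]; have lt_i := ltn_trans lt_ij lt_j.
  case: ifP => // nl; have nij : i != j by rewrite neq_ltn lt_ij.
  rewrite -code_add_edge // has_diamondE //; apply/diamondP; apply: H.
    by rewrite nth_uniq ?size_repr.
  by rewrite adj_nth // nl.
split=> [|u v nuv nadj]; first exact: repr_free.
(* Adding an edge keeps the vertex type, so s enumerates the new graph too. *)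
apply/diamondP; rewrite -(@has_diamondE (add_edge u v) s ps).
have := @code_add_edge (index u s) (index v s) (lt_index u) (lt_index v).
rewrite !nth_index // => ->; last first.
  by apply: contra nuv => /eqP E; rewrite -(nth_index x0 (sG u)) E nth_index.
have : index u s != index v s.
  by apply: contra nuv => /eqP E; rewrite -(nth_index x0 (sG u)) E nth_index.
have := adj_nth x0 (lt_index u) (lt_index v); rewrite !nth_index // (negbTE nadj) => /esym nl.
(* The test covers only i < j; the other order follows by symmetry. *)
rewrite neq_ltn => /orP[lt_uv|lt_vu].
  by have := H _ _ (introT andP (conj lt_uv (lt_index v))); rewrite nl.
by have := H _ _ (introT andP (conj lt_vu (lt_index u))); rewrite link_sym nl add_codeC.
Qed.

Lemma repr_minimal : minimal_arrowing [:: 2; 2; 2; 2] G <-> k < 2.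
Proof.
have -> : k < 2 <-> minimal_test k.
  case/and5P: targets_okT => _ _ _ _ /andP[_ /allP/(_ k)].
  by rewrite mem_iota => /(_ lt_k)/eqP->.
split=> [[_ H]|/all_pairsP H].
  apply/all_pairsP=> i j /andP[lt_ij lt_j]; have lt_i := ltn_trans lt_ij lt_j.
  case: ifP => // l; have nij : i != j by rewrite neq_ltn lt_ij.
  rewrite -code_del_edge //; apply/negPn/negP=> nc.
  apply: (H (nth x0 s i) (nth x0 s j)); first by rewrite adj_nth.
  apply/arrows_colorable.
  by move/(@any_col_colorable (del_edge (nth x0 s i) (nth x0 s j)) s ps); apply/negP.
split=> [|u v uv]; first exact: repr_arrows.
move/arrows_colorable; apply; apply/(@any_col_colorable (del_edge u v) s ps).
have nuv : u != v by apply/eqP=> E; rewrite E adj_irrefl in uv.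
have nij : index u s != index v s.
  by apply: contra nuv => /eqP E; rewrite -(nth_index x0 (sG u)) E nth_index.
have := @code_del_edge (index u s) (index v s) (lt_index u) (lt_index v) nij.
rewrite !nth_index // => ->.
have := adj_nth x0 (lt_index u) (lt_index v); rewrite !nth_index // uv => /esym l.
move: nij; rewrite neq_ltn => /orP[lt_uv|lt_vu].
  by have := H _ _ (introT andP (conj lt_uv (lt_index v))); rewrite l.
by have := H _ _ (introT andP (conj lt_vu (lt_index u))); rewrite link_sym l del_codeC.
Qed.

End Represented.

(** * Counting up to isomorphism *)

Lemma represents_isomorphic G H k : represents G k -> represents H k -> isomorphic G H.
Proof.
case=> s ps Es [t pt Et].
have sz_s := size_repr Es; have sz_t := size_repr Et.
have [us ut] : uniq s /\ uniq t by rewrite (perm_uniq ps) (perm_uniq pt) !enum_uniq.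
have x0 : G by case: (s) sz_s.
have y0 : H by case: (t) sz_t.
have sG x : x \in s by rewrite (perm_mem ps) mem_enum.
have tH y : y \in t by rewrite (perm_mem pt) mem_enum.
exists (fun x => nth y0 t (index x s)); split.
  exists (fun y => nth x0 s (index y t)) => x.
    by rewrite index_uniq ?nth_index // sz_t -sz_s index_mem.
  by rewrite index_uniq ?nth_index // sz_s -sz_t index_mem.
move=> x y; rewrite (adj_nth Et) -?sz_s ?index_mem //.
by rewrite -{2}(nth_index x0 (sG x)) -{2}(nth_index x0 (sG y)) (adj_nth Es) -?sz_s ?index_mem.
Qed.

Lemma codegree_energyE (G : sgraph) (s : seq G) : codegree_energy (code (@adj G) s) =
  sumn [seq sumn [seq (let c := count (fun z => adj x z && adj y z) s in c * c) | y <- s] | x <- s].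
Proof.
rewrite /codegree_energy full_cd -map_comp; congr sumn; apply: eq_map => x /=.
rewrite -map_comp; congr sumn; apply: eq_map => y /=.
by rewrite band_map count_map.
Qed.

Lemma perm_codegree_energy (G : sgraph) (s t : seq G) : perm_eq s t ->
  codegree_energy (code (@adj G) s) = codegree_energy (code (@adj G) t).
Proof.
move=> p; rewrite !codegree_energyE -(perm_sumn (perm_map _ p)).
congr sumn; apply: eq_map => x; rewrite -(perm_sumn (perm_map _ p)).
by congr sumn; apply: eq_map => y; rewrite (permP p).
Qed.

(** An isomorphism preserves [codegree_energy], whose values on the five targets are distinct. *)
Lemma represents_inj G H k l : k < 5 -> l < 5 ->
  represents G k -> represents H l -> isomorphic G H -> k = l.
Proof.
move=> lt_k lt_l [s ps Es] [t pt Et] [f [bij_f adj_f]].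
have p : perm_eq (map f s) t.
  have [us ut] : uniq s /\ uniq t by rewrite (perm_uniq ps) (perm_uniq pt) !enum_uniq.
  apply: uniq_perm; rewrite ?map_inj_uniq //; first exact: bij_inj.
  move=> y; rewrite (perm_mem pt) mem_enum; have [g fK gK] := bij_f.
  by rewrite -(gK y) map_f // (perm_mem ps) mem_enum.
have := perm_codegree_energy p; rewrite (code_map s adj_f) Es Et => E.
have [_ _ _ uE _] := and5P targets_okT.
have szE : size [seq codegree_energy (target k) | k <- iota 0 5] = 5 by rewrite size_map size_iota.
apply/eqP; rewrite -(nth_uniq 0 _ _ uE) ?szE //.
by rewrite !(nth_map 0) ?size_iota // !nth_iota // !add0n E.
Qed.

Lemma exactly_represented (ks : seq nat) (P : sgraph -> Prop) :
  uniq ks -> {subset ks <= iota 0 5} ->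
  (forall G, P G <-> exists2 k, k \in ks & represents G k) ->
  exactly_upto_iso (size ks) P.
Proof.
move=> uks ks5 PE; have rep k := target_graph_represents k.
have lt5 k : k \in ks -> k < 5 by move/ks5; rewrite mem_iota.
have ksi (i : 'I_(size ks)) : nth 0 ks i \in ks by rewrite mem_nth.
exists (fun i => target_graph (nth 0 ks i)); split=> [i|i j iso|G].
- by apply/PE; exists (nth 0 ks i).
- apply/val_inj/eqP; rewrite -(nth_uniq 0 (ltn_ord i) (ltn_ord j) uks); apply/eqP.
  exact: (represents_inj (lt5 _ (ksi i)) (lt5 _ (ksi j)) (rep _) (rep _) iso).
- case/PE=> k kin repG; have lt_i : index k ks < size ks by rewrite index_mem.
  exists (Ordinal lt_i); apply: represents_isomorphic repG.
  by rewrite /= nth_index.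
Qed.

Definition pad_adj (G : sgraph) n : rel (G + 'I_n) := fun x y =>
  match x, y with inl u, inl w => adj u w | _, _ => false end.

Fact pad_adj_sym G n : symmetric (@pad_adj G n).
Proof. by move=> [x|i] [y|j] //=; apply: adj_sym. Qed.

Fact pad_adj_irrefl G n : irreflexive (@pad_adj G n).
Proof. by move=> [x|i] //=; apply: adj_irrefl. Qed.

Definition pad (G : sgraph) n := SGraph (@pad_adj_sym G n) (@pad_adj_irrefl G n).

Lemma freeP G : free (J 4) G <-> diamond_free G.
Proof.
split=> [fr|df].
  by apply/diamond_freeP/negP => d; apply: fr; apply/diamondP.
by move=> /diamondP d; move/diamond_freeP: df; rewrite d.
Qed.

(** Padded to 15 vertices, a smaller graph would still be J_4-free and not 4-colorable, hence have a
    target code; but a padding vertex is isolated and no target has an isolated vertex. *)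
Lemma Folkman_represented (G : sgraph) : #|G| <= 15 -> free (J 4) G -> arrows G [:: 2; 2; 2; 2] ->
  #|G| = 15 /\ exists2 k, k < 5 & represents G k.
Proof.
move=> le15 /freeP dfG /arrows_colorable ncol.
case: (ltnP #|G| 15) => [lt15|ge15]; last first.
  have E : #|G| = 15 by apply/eqP; rewrite eqn_leq le15.
  by split=> //; apply: classification.
pose G' := pad G (15 - #|G|); exfalso.
have card' : #|G'| = 15 by rewrite card_sum card_ord subnKC.
have dfG' : diamond_free G'.
  by move=> [x|i] [y|j] [a|k] [b|l] //= xy xa ya xb yb; congr inl; apply: (dfG x y).
have ncol' : ~ colorable 4 (enum G').
  move=> [c [ck cp]]; apply: ncol; exists (fun x => c (inl x)).
  have en z : z \in enum G' by rewrite mem_enum.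
  by split=> [x _|x y _ _ xy]; [apply: ck | apply: cp].
have [k lt_k [s ps Es]] := classification dfG' card' ncol'.
have lt_n : 0 < 15 - #|G| by rewrite subn_gt0.
have iso_s : inr (Ordinal lt_n) \in s by rewrite (perm_mem ps) mem_enum.
have [_ _ /allP/(_ k) H _ _] := and5P targets_okT.
move: H; rewrite mem_iota => /(_ lt_k); rewrite -Es full_cd => /allP.
move/(_ _ (map_f (fun x => map (@adj G' x) s) iso_s)).
by rewrite has_map => /hasP[].
Qed.

Lemma Folkman_graphP G : Folkman_graph [:: 2; 2; 2; 2] (J 4) 15 G <->
  exists2 k, k \in iota 0 5 & represents G k.
Proof.
split=> [[c15 fr ar]|[k]].
  have [|_ [k lt_k rG]] := Folkman_represented _ fr ar; first by rewrite c15.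
  by exists k; rewrite ?mem_iota.
rewrite mem_iota => /= lt_k [s ps Es]; split.
- exact: card_repr ps Es.
- exact: repr_free lt_k ps Es.
- exact: repr_arrows lt_k ps Es.
Qed.

Theorem theorem4 :
  vertex_Folkman_number [:: 2; 2; 2; 2] (J 4) 15 /\
  exactly_upto_iso 5 (Folkman_graph [:: 2; 2; 2; 2] (J 4) 15) /\
  exactly_upto_iso 1 (fun G => Folkman_graph [:: 2; 2; 2; 2] (J 4) 15 G /\
                               maximal_free (J 4) G) /\
  exactly_upto_iso 2 (fun G => Folkman_graph [:: 2; 2; 2; 2] (J 4) 15 G /\
                               minimal_arrowing [:: 2; 2; 2; 2] G).
Proof.
split; last split; last split.
- split=> [|m G [<- fr ar]].
    exists (target_graph 0); apply/Folkman_graphP.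
    by exists 0; last exact: target_graph_represents.
  rewrite leqNgt; apply/negP=> lt15.
  by have [E _] := Folkman_represented (ltnW lt15) fr ar; rewrite E in lt15.
- exact: (@exactly_represented (iota 0 5) _ _ _ Folkman_graphP).
- apply: (@exactly_represented [:: 4]) => // [k|G]; first by rewrite inE => /eqP->.
  split=> [[/Folkman_graphP[k]]|[k]].
    rewrite mem_iota => lt_k [s ps Es] /(repr_maximal lt_k ps Es) k4.
    by exists k; [rewrite inE k4 | exists s].
  rewrite inE => /eqP-> r4; split; first by apply/Folkman_graphP; exists 4.
  by case: r4 => s ps Es; apply/(repr_maximal _ ps Es).
- apply: (@exactly_represented [:: 0; 1]) => // [k|G]; first by rewrite !inE => /orP[]/eqP->.
  split=> [[/Folkman_graphP[k]]|[k]].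
    rewrite mem_iota => lt_k [s ps Es] /(repr_minimal lt_k ps Es) lt2.
    by exists k; [case: k lt2 {Es lt_k} => [|[]] | exists s].
  rewrite !inE => k01 rk; have lt2 : k < 2 by case/orP: k01 => /eqP->.
  have lt5 : k < 5 by apply: leq_trans lt2 _.
  split; first by apply/Folkman_graphP; exists k; rewrite ?mem_iota.
  by case: rk => s ps Es; apply/(repr_minimal lt5 ps Es).
Qed.
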